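(* Let $G$ be a connected simple graph with $n\ge 2$ vertices. Then $S_2(G)\leq e(G)+3$.
   Context: Graphs are finite, simple and connected. For a graph $G$, $e(G)$ is its number of edges, $A(G)$ its adjacency matrix, $D(G)$ the diagonal matrix of vertex degrees, and $Q(G)=D(G)+A(G)$ its signless Laplacian matrix, with eigenvalues (counted with multiplicity) $q_1(G)\ge q_2(G)\ge\cdots\ge q_n(G)$. Put $S_2(G)=q_1(G)+q_2(G)$. *)

(* Defs.v *)
From HB Require Import structures.
From mathcomp Require Import all_boot all_order all_algebra.
From mathcomp Require Import spectral sesquilinear.
From mathcomp Require Import reals.
From mathcomp Require Import polyrcf complex.

Set Implicit Arguments.
Unset Strict Implicit.
Unset Printing Implicit Defensive.

Import Order.TTheory GRing.Theory Num.Theory.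
Local Open Scope ring_scope.

(* The eigenvalues in R of a square matrix, each repeated according to its
   algebraic multiplicity, in nonincreasing order: q_i is the entry of index
   i - 1.  For a symmetric matrix this is the whole spectrum, see
   char_poly_eigenvalues. *)
Definition eigenvalues (R : rcfType) (n : nat) (A : 'M[R]_n) : seq R :=
  sort >=%R (flatten [seq nseq (mup x (char_poly A)) x
                     | x <- rootsR (char_poly A)]).

Lemma eigenvalues_sorted (R : rcfType) (n : nat) (A : 'M[R]_n) :
  sorted >=%R (eigenvalues A).
Proof. by apply: sort_sorted => x y; apply: ge_total. Qed.

Lemma eigenvalues_split (R : rcfType) (n : nat) (A : 'M[R]_n) (s : seq R) :
  char_poly A = \prod_(x <- s) ('X - x%:P) -> perm_eq (eigenvalues A) s.
Proof.
move=> ps; have p0 : char_poly A != 0 by rewrite monic_neq0 ?char_poly_monic.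
rewrite /eigenvalues perm_sort; apply/allP => x _ /=.
rewrite count_flatten -map_comp; apply/eqP.
rewrite -mu_prod_XsubC -ps.
set p := char_poly A in p0 *.
have H y : count_mem x (nseq (mup y p) y) = ((y == x) * mup x p)%N.
  by rewrite count_nseq /=; case: eqP => [->|]; rewrite ?mul1n ?mul0n.
rewrite sumnE big_map (eq_bigr _ (fun y _ => H y)).
have rP y : root p y = (y \in rootsR p).
  by have /roots_onP/(_ y) := roots_on_rootsR p0; apply; rewrite in_itv.
have [xr|xnr] := boolP (x \in rootsR p).
  rewrite (bigD1_seq x) ?uniq_roots //= eqxx mul1n big1 ?addn0 // => y.
  by move=> /negPf ->.
rewrite (@mupNroot _ x p) ?rP //; apply: big1 => y _; exact: muln0.
Qed.

Lemma char_poly_conj (F : fieldType) (n : nat) (P B : 'M[F]_n) :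
  P \in unitmx -> char_poly (invmx P *m B *m P) = char_poly B.
Proof.
move=> Pu; rewrite /char_poly.
have PP : map_mx polyC (invmx P) *m map_mx polyC P = 1%:M.
  by rewrite -map_mxM mulVmx // map_mx1.
have -> : char_poly_mx (invmx P *m B *m P) =
    map_mx polyC (invmx P) *m char_poly_mx B *m map_mx polyC P.
  rewrite /char_poly_mx !map_mxM mulmxBr mulmxBl; congr (_ - _).
  by rewrite -mulmxA -scalar_mxC mulmxA PP mul1mx.
by rewrite !det_mulmx mulrAC -det_mulmx PP det1 mul1r.
Qed.

Lemma char_poly_eigenvalues (R : rcfType) (n : nat) (A : 'M[R]_n) :
  A^T = A -> char_poly A = \prod_(x <- eigenvalues A) ('X - x%:P).
Proof.
move=> symA; pose B : 'M[R[i]]_n := map_mx (real_complex R) A.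
have Bh : B \is hermsymmx.
  apply: realsym_hermsym.
    by apply/is_hermitianmxP; rewrite expr0 scale1r map_mx_id // map_trmx symA.
  by apply/mxOverP => i j; rewrite mxE; apply/complex_realP; exists (A i j).
have /mxOverP dr := hermitian_spectral_diag_real Bh.
have /orthomx_spectralP Beq := hermitian_normalmx Bh.
pose s := [seq complex.Re (spectral_diag B ord0 j) | j : 'I_n].
suff ps : char_poly A = \prod_(x <- s) ('X - x%:P).
  by rewrite [LHS]ps; apply/esym/perm_big/eigenvalues_split.
apply: (map_poly_inj (real_complex R)).
rewrite map_char_poly -/B {1}Beq char_poly_conj ?spectral_unit //.
rewrite char_poly_trig ?diag_mx_is_trig //.
rewrite /s big_image /= rmorph_prod /=; apply: eq_bigr => j _.
by rewrite mxE eqxx mulr1n map_polyXsubC /= RRe_real.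
Qed.

Lemma size_eigenvalues (R : rcfType) (n : nat) (A : 'M[R]_n) :
  A^T = A -> size (eigenvalues A) = n.
Proof.
move=> /char_poly_eigenvalues /(congr1 (size \o polyseq)) /=.
by rewrite size_char_poly size_prod_XsubC => -[].
Qed.

(* A simple graph on V is given by its adjacency relation, a symmetric and
   irreflexive e : rel V. *)
Definition edges (V : finType) (e : rel V) : {set {set V}} :=
  [set E | [exists x, exists y, e x y && (E == [set x; y])]].

Definition edge_count (V : finType) (e : rel V) : nat := #|edges e|.

Definition degree (V : finType) (e : rel V) (x : V) : nat := #|[set y | e x y]|.

Definition connected_graph (V : finType) (e : rel V) : Prop :=
  forall x y : V, connect e x y.

(* Matrices are indexed by 'I_#|V|, identified with V through enum_val. *)
Definition adjacency_mx (R : realType) (V : finType) (e : rel V) :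
    'M[R]_#|V| :=
  \matrix_(i, j) (e (enum_val i) (enum_val j))%:R.

Definition degree_mx (R : realType) (V : finType) (e : rel V) : 'M[R]_#|V| :=
  diag_mx (\row_i (degree e (enum_val i))%:R).

Definition signless_laplacian (R : realType) (V : finType) (e : rel V) :
    'M[R]_#|V| :=
  degree_mx R e + adjacency_mx R e.

Lemma signless_laplacian_sym (R : realType) (V : finType) (e : rel V) :
  symmetric e -> (signless_laplacian R e)^T = signless_laplacian R e.
Proof.
move=> esym; rewrite /signless_laplacian linearD /= tr_diag_mx; congr (_ + _).
by apply/matrixP => i j; rewrite !mxE esym.
Qed.

(* signless_eigenvalue R e k is q_(k+1) of the graph e. *)
Definition signless_eigenvalue (R : realType) (V : finType) (e : rel V)
    (k : nat) : R :=
  (eigenvalues (signless_laplacian R e))`_k.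

Definition S2 (R : realType) (V : finType) (e : rel V) : R :=
  signless_eigenvalue R e 0 + signless_eigenvalue R e 1.

(* Main.v *)
(* The sum q_1 + q_2 equals tr (P Q), where P is the real part of the orthogonal
   projection onto two top eigenvectors; P is symmetric with P^2 <= P and trace
   2, and the claim becomes that the sum of P_ii + P_jj + 2 P_ij - 1 over the
   edges ij is at most 3.  Induct on the number of edges by deleting a vertex v
   of maximal degree k, leaving a graph h with c edges.  Row v of P^2 <= P and
   AM-GM bound the contribution of the star at v, and Ky Fan's inequality bounds
   the remaining part of the trace by q_1(h) + (1 - P_vv) q_2(h).  With the
   induction hypothesis this suffices when q_1(h) <= c + mu and
   k <= (2 - mu) (k - 2); in particular when k >= 4 and q_1(h) <= c.  The bound
   q_1 <= max_w (deg w + mean degree of the neighbours of w) leaves the cases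
   where h is a star (then two vertices cover all edges, and the two
   corresponding rows of P suffice), where h is a triangle, and a short list of
   exceptions.  The exceptions and the graphs of maximal degree at most 3 obey a
   Cauchy-Schwarz estimate of tr (P Q) in terms of the degrees. *)

Require Import Defs.
From mathcomp Require Import all_boot all_order fingroup perm all_algebra.
From mathcomp Require Import spectral sesquilinear.
From mathcomp Require Import reals.
From mathcomp Require Import polyrcf complex.
From mathcomp Require Import ring lra zify.

Set Implicit Arguments.
Unset Strict Implicit.
Unset Printing Implicit Defensive.

Import Order.TTheory GRing.Theory Num.Theory.
Local Open Scope ring_scope.

(** * The Ky Fan variational principle *)

(** The spectral theorem yields the eigenvalues in no particular order; the permutation matches them
    with the sorted list. *)
Lemma eigenvalues_nth_perm (R : rcfType) (n : nat) (A : 'M[R]_n)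
    (d : 'I_n -> R) :
    perm_eq (eigenvalues A) [seq d j | j : 'I_n] ->
  exists s : 'S_n, forall i : 'I_n, (eigenvalues A)`_i = d (s i).
Proof.
move=> pe.
have sz : size (eigenvalues A) == n.
  by rewrite (perm_size pe) size_image card_ord.
have sz' : size [seq d j | j : 'I_n] == n by rewrite size_image card_ord.
have /tuple_permP[s Es] : perm_eq (Tuple sz) (Tuple sz') by exact: pe.
exists s => i; have -> : (eigenvalues A)`_i = tnth (Tuple sz) i.
  by rewrite (tnth_nth 0).
have -> : tnth (Tuple sz) i = nth 0 (Tuple sz) i by rewrite (tnth_nth 0).
rewrite Es -tnth_nth tnth_mktuple (tnth_nth 0) /=.
by rewrite (nth_map (s i)) ?size_enum_ord // nth_ord_enum.
Qed.

Lemma eqC_split (R : rcfType) (a b c : R) :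
  (a%:C + 'i * b%:C = c%:C)%C -> a = c /\ b = 0.
Proof.
move/eqP; rewrite eq_complex /= !(mul0r, mul1r, addr0, add0r, subr0, oppr0).
by case/andP => /eqP -> /eqP.
Qed.

Lemma map_mxC_split (R : rcfType) (m n : nat) (A B C : 'M[R]_(m, n)) :
  map_mx (real_complex R) A + 'i%C *: map_mx (real_complex R) B =
    map_mx (real_complex R) C -> A = C /\ B = 0.
Proof.
move=> /matrixP E; have H i j := E i j.
split; apply/matrixP => i j; move: (H i j); rewrite !mxE;
  by case/eqC_split.
Qed.

Local Notation "M ^t*" := (map_mx (@Num.conj _) M^T).

(* X + i Y is unitary and its rows are eigenvectors of A. *)
Lemma spectral_real (R : rcfType) (n : nat) (A : 'M[R]_n) :
    A^T = A ->
  exists X Y : 'M[R]_n, let L := diag_mx (\row_i (eigenvalues A)`_i) in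
  [/\ X *m X^T + Y *m Y^T = 1%:M, Y *m X^T = X *m Y^T,
      X^T *m X + Y^T *m Y = 1%:M, X *m A = L *m X & Y *m A = L *m Y].
Proof.
move=> symA; pose B : 'M[R[i]]_n := map_mx (real_complex R) A.
have Bh : B \is hermsymmx.
  apply: realsym_hermsym.
    by apply/is_hermitianmxP; rewrite expr0 scale1r map_mx_id // map_trmx symA.
  by apply/mxOverP => i j; rewrite mxE; apply/complex_realP; exists (A i j).
have /mxOverP dr := hermitian_spectral_diag_real Bh.
have /orthomx_spectralP Beq := hermitian_normalmx Bh.
set U0 := spectralmx B in Beq; set D := spectral_diag B in Beq dr.
have U0u : U0 \is unitarymx := spectral_unitarymx B.
have [s Es] : exists s : 'S_n, forall i : 'I_n,
    (eigenvalues A)`_i = complex.Re (D ord0 (s i)).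
  apply: (@eigenvalues_nth_perm _ _ A (fun j => complex.Re (D ord0 j))).
  apply: eigenvalues_split; apply: (map_poly_inj (real_complex R)).
  rewrite map_char_poly -/B {1}Beq char_poly_conj ?spectral_unit //.
  rewrite char_poly_trig ?diag_mx_is_trig //.
  rewrite big_image /= rmorph_prod /=; apply: eq_bigr => j _.
  by rewrite mxE eqxx mulr1n map_polyXsubC /= RRe_real.
have DE i : D ord0 (s i) = ((eigenvalues A)`_i)%:C%C by rewrite Es RRe_real.
have U0B : U0 *m B = diag_mx D *m U0.
  by rewrite {1}Beq -mulmxA mulKVmx ?spectral_unit.
have U0U : U0 *m U0^t* = 1%:M by apply/unitarymxP.
(* After this reordering, row i of [U] belongs to entry i of the sorted spectrum. *)
pose U := row_perm s U0.
have UU : U *m U^t* = 1%:M.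
  apply/matrixP => i j; move/matrixP/(_ (s i) (s j)): U0U; rewrite !mxE.
  rewrite (inj_eq perm_inj) => <-; apply: eq_bigr => k _.
  by rewrite !mxE.
have UB i j : (U *m B) i j = ((eigenvalues A)`_i)%:C%C * U i j.
  move/matrixP/(_ (s i) j): U0B; rewrite mul_diag_mx !mxE DE => <-.
  by apply: eq_bigr => k _; rewrite !mxE.
pose X := map_mx (@complex.Re R) U; pose Y := map_mx (@complex.Im R) U.
have UE i j : U i j = ((X i j)%:C + 'i * (Y i j)%:C)%C.
  by rewrite !mxE -complexE.
have UE' : U = map_mx (real_complex R) X + 'i%C *: map_mx (real_complex R) Y.
  by apply/matrixP => i j; rewrite UE !mxE.
have UtE : U^t* = map_mx (real_complex R) X^T
                  - 'i%C *: map_mx (real_complex R) Y^T.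
  apply/matrixP => i j; rewrite !mxE; case: (U0 (s j) i) => a b /=.
  by apply/eqP; rewrite eq_complex /= !(mul0r,mul1r,addr0,add0r,subr0,oppr0)
     !eqxx.
have ii : 'i%C * 'i%C = -1 :> R[i] by rewrite -expr2 sqr_i.
exists X, Y => L.
(* These are the real and imaginary parts of [UU]; [e3] and [e4] come from the product in the other
   order. *)
have [e1 e2] : X *m X^T + Y *m Y^T = 1%:M /\ Y *m X^T - X *m Y^T = 0.
  apply: map_mxC_split; rewrite map_mx1 -UU UtE UE'.
  rewrite mulmxDl !mulmxBr -!scalemxAl -!scalemxAr scalerA ii -!map_mxM.
  rewrite scaleN1r opprK map_mxD map_mxB scalerBr.
  by rewrite addrACA [RHS]addrACA; congr (_ + _); apply: addrC.
have [e3 e4] : X^T *m X + Y^T *m Y = 1%:M /\ X^T *m Y - Y^T *m X = 0.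
  apply: map_mxC_split; rewrite map_mx1 -(mulmx1C UU) UtE UE'.
  rewrite mulmxDr !mulmxBl -!scalemxAl -!scalemxAr scalerA ii -!map_mxM.
  rewrite scaleN1r opprK map_mxD map_mxB scalerBr.
  by rewrite addrACA [RHS]addrACA; congr (_ + _); apply: addrC.
have e5 i j : (X *m A) i j = (eigenvalues A)`_i * X i j /\
              (Y *m A) i j = (eigenvalues A)`_i * Y i j.
  have : (U *m B) i j = (((X *m A) i j)%:C + 'i * ((Y *m A) i j)%:C)%C.
    by rewrite UE' mulmxDl -scalemxAl -!map_mxM !mxE.
  rewrite UB UE => /eqP; rewrite eq_complex /=.
  rewrite !(mul0r,mul1r,addr0,add0r,subr0, oppr0).
  by case/andP => /eqP -> /eqP ->.
split=> //; first by apply/eqP; rewrite -subr_eq0 e2.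
- by apply/matrixP => i j; rewrite (e5 i j).1 mul_diag_mx !mxE.
- by apply/matrixP => i j; rewrite (e5 i j).2 mul_diag_mx !mxE.
Qed.

Definition bf (R : pzRingType) (n : nat) (A : 'M[R]_n) (y z : 'rV[R]_n) : R :=
  (y *m A *m z^T) ord0 ord0.

Definition sqnorm (R : pzRingType) (n : nat) (z : 'rV[R]_n) : R :=
  \sum_i z ord0 i ^+ 2.

Lemma sqnorm_ge0 (R : realDomainType) (n : nat) (z : 'rV[R]_n) :
  0 <= sqnorm z.
Proof. by apply: sumr_ge0 => i _; apply: sqr_ge0. Qed.

Lemma sqnormE (R : comPzRingType) (n : nat) (z : 'rV[R]_n) :
  sqnorm z = (z *m z^T) ord0 ord0.
Proof. by rewrite mxE; apply: eq_bigr => i _; rewrite mxE expr2. Qed.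

Lemma bfE (R : comPzRingType) (n : nat) (A : 'M[R]_n) (y z : 'rV[R]_n) :
  bf A y z = \sum_i \sum_j y ord0 i * A i j * z ord0 j.
Proof.
rewrite /bf mxE exchange_big; apply: eq_bigr => j _; rewrite !mxE big_distrl.
by apply: eq_bigr.
Qed.

(* Real parts of orthogonal projections of a complexified Euclidean space. *)
Definition contraction (R : numDomainType) (n : nat) (P : 'M[R]_n) : Prop :=
  P^T = P /\ forall z : 'rV_n, sqnorm (z *m P) <= bf P z z.

(** The rows of U = X + i Y form an orthonormal eigenbasis, [D] selects the first two, and P + i Z
    is the projection onto their span. As Z is antisymmetric, the real part of idempotence reads P P
    + Z Z^T = P, hence P^2 <= P. *)
Lemma ky_fan_attained (R : rcfType) (n : nat) (A : 'M[R]_n) :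
    (2 <= n)%N -> A^T = A ->
  exists P : 'M[R]_n, [/\ contraction P, \tr P = 2 &
    \tr (P *m A) = (eigenvalues A)`_0 + (eigenvalues A)`_1].
Proof.
move=> n2 symA; have [X [Y [e1 e2 _ eX eY]]] := spectral_real symA.
set L := diag_mx _ in eX eY.
pose D : 'M[R]_n := diag_mx (\row_(i < n) (i < 2)%:R).
have DT : D^T = D by rewrite tr_diag_mx.
have DD : D *m D = D.
  rewrite /D; apply/matrixP => i j; rewrite mul_diag_mx !mxE.
  by case: (i < 2)%N; rewrite /= ?mul1r ?mul0r ?mul0rn.
have trE (d : 'rV[R]_n) : \tr (D *m diag_mx d) =
    d ord0 (Ordinal (leq_trans (isT : 0 < 2)%N n2))
    + d ord0 (Ordinal n2).
  rewrite /mxtrace (eq_bigr (fun i : 'I_n => (i < 2)%:R * d ord0 i)); last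
      first.
    by move=> i _; rewrite mul_diag_mx !mxE eqxx mulr1n.
  case: n n2 d {symA A X Y e1 e2 eX eY L D DT DD} => [//|[//|n]] n2 d.
  rewrite !big_ord_recl /= !mul1r big1 ?addr0 => [|i _]; last by rewrite mul0r.
  by congr (d _ _ + d _ _); apply: val_inj.
pose P := X^T *m D *m X + Y^T *m D *m Y.
pose Z := X^T *m D *m Y - Y^T *m D *m X.
have trP B : \tr (X^T *m D *m B *m X + Y^T *m D *m B *m Y) = \tr (D *m B).
  rewrite linearD /= -!(mulmxA _^T) ![\tr (_^T *m _)]mxtrace_mulC -!mulmxA.
  by rewrite -linearD /= -!mulmxDr e1 mulmx1.
have PT : P^T = P by rewrite /P linearD /= !trmx_mul !trmxK !DT !mulmxA.
have ZT : Z^T = Y^T *m D *m X - X^T *m D *m Y.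
  by rewrite /Z linearB /= !trmx_mul !trmxK !DT !mulmxA.
have PZ : P *m P + Z *m Z^T = P.
  have XX : X *m X^T = 1%:M - Y *m Y^T by rewrite -e1 addrK.
  have YY : Y *m Y^T = 1%:M - X *m X^T by rewrite -e1 addrC addKr.
  have T1 : X^T *m D *m X *m (X^T *m D *m X) =
      X^T *m D *m X - X^T *m D *m Y *m (Y^T *m D *m X).
    rewrite !mulmxA -[X^T *m D *m X *m X^T]mulmxA XX mulmxBr mulmx1 !mulmxBl.
    by rewrite -[X^T *m D *m D]mulmxA DD !mulmxA.
  have T4 : Y^T *m D *m Y *m (Y^T *m D *m Y) =
      Y^T *m D *m Y - Y^T *m D *m X *m (X^T *m D *m Y).
    rewrite !mulmxA -[Y^T *m D *m Y *m Y^T]mulmxA YY mulmxBr mulmx1 !mulmxBl.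
    by rewrite -[Y^T *m D *m D]mulmxA DD !mulmxA.
  have T2 : X^T *m D *m X *m (Y^T *m D *m Y) =
            X^T *m D *m Y *m (X^T *m D *m Y).
    by rewrite !mulmxA -[X^T *m D *m X *m Y^T]mulmxA -e2 !mulmxA.
  have T3 : Y^T *m D *m Y *m (X^T *m D *m X) =
            Y^T *m D *m X *m (Y^T *m D *m X).
    by rewrite !mulmxA -[Y^T *m D *m Y *m X^T]mulmxA e2 !mulmxA.
  rewrite ZT /Z /P; rewrite ?mulmxDl ?mulmxDr ?mulmxBl ?mulmxBr T1 T2 T3 T4.
  rewrite !(mulmxN, mulNmx) opprK.
  move: (X^T *m D *m Y *m (Y^T *m D *m X)) (X^T *m D *m Y *m (X^T *m D *m Y))
    (Y^T *m D *m X *m (Y^T *m D *m X)) (Y^T *m D *m X *m (X^T *m D *m Y))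
    (X^T *m D *m X) (Y^T *m D *m Y) => a b c d p q.
  by apply/matrixP => i j; rewrite !mxE; ring.
exists P; split; first split=> // z.
- rewrite -subr_ge0 (_ : _ - _ = sqnorm (z *m Z)) ?sqnorm_ge0 //.
  have -> : bf P z z = sqnorm (z *m P) + sqnorm (z *m Z); last by rewrite
      addrC addKr.
  rewrite !sqnormE /bf -[in LHS]PZ mulmxDr mulmxDl !trmx_mul PT !mulmxA.
  by rewrite mxE.
- by have := trP 1%:M; rewrite !mulmx1 => ->; rewrite -[D]mulmx1
    -diag_const_mx trE !mxE.
- have -> : P *m A = X^T *m D *m L *m X + Y^T *m D *m L *m Y.
    by rewrite /P mulmxDl -!mulmxA eX eY !mulmxA.
  by rewrite trP trE !mxE.
Qed.

(** In the eigenbasis the trace is a combination of the eigenvalues with weights [w i] in [0, 1] of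
    total 1 + t; moving weight towards the front of the list can only increase it. *)
Lemma ky_fan_le (R : rcfType) (n : nat) (A W : 'M[R]_n) (t : R) :
    A^T = A -> (2 <= n)%N ->
    (forall z : 'rV_n, 0 <= bf W z z <= sqnorm z) -> \tr W = 1 + t ->
  \tr (W *m A) <= (eigenvalues A)`_0 + t * (eigenvalues A)`_1.
Proof.
move=> symA n2 Wb trW; have [X [Y [e1 e2 e3 eX eY]]] := spectral_real symA.
set L := diag_mx _ in eX eY; pose E i := (eigenvalues A)`_i.
have AE : A = X^T *m L *m X + Y^T *m L *m Y.
  by rewrite -!mulmxA -eX -eY !mulmxA -mulmxDl e3 mul1mx.
pose w (i : 'I_n) := bf W (row i X) (row i X) + bf W (row i Y) (row i Y).
have bfrow (B : 'M[R]_n) i : (B *m W *m B^T) i i = bf W (row i B) (row i B).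
  rewrite /bf -row_mul !mxE; apply: eq_bigr => k _.
  by rewrite !mxE.
have wi i : 0 <= w i <= 1.
  have /andP[x0 x1] := Wb (row i X); have /andP[y0 y1] := Wb (row i Y).
  rewrite addr_ge0 //=; apply: le_trans (lerD x1 y1) _.
  rewrite !sqnormE !tr_row.
  move/matrixP/(_ i i): e1; rewrite !mxE eqxx mulr1n => <-.
  by apply: lerD; apply: ler_sum => j _; rewrite !mxE.
have trB (B : 'rV[R]_n) : \tr (W *m (X^T *m diag_mx B *m X + Y^T *m diag_mx B
    *m Y)) =
    \sum_i B ord0 i * w i.
  rewrite mulmxDr linearD /= !mulmxA [\tr (_ *m X)]mxtrace_mulC.
  rewrite [\tr (_ *m Y)]mxtrace_mulC !mulmxA -big_split /=.
  apply: eq_bigr => i _; rewrite /w -!bfrow mulrDr.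
  by rewrite !mul_mx_diag !mxE ![_ * B _ _]mulrC.
have sw : \sum_i w i = 1 + t.
  rewrite -trW -[in RHS](mulmx1 W) -e3.
  have := trB (const_mx 1); rewrite diag_const_mx !mulmx1 => ->.
  by apply: eq_bigr => i _; rewrite mxE mul1r.
have E10 : E 1%N <= E 0%N.
  have := eigenvalues_sorted A; move: (size_eigenvalues symA); rewrite /E.
  case: (eigenvalues A) => [|a [|b s]] //=; first by move=> Hn; rewrite -Hn in
      n2.
  by move=> _ /andP[].
have Ei (i : 'I_n) : (0 < i)%N -> E i <= E 1%N.
  move=> i0; have := eigenvalues_sorted A => srt.
  by apply: (sorted_leq_nth ge_trans ge_refl) => //; rewrite inE
      size_eigenvalues.
rewrite {1}AE trB; pose i0 := Ordinal (leq_trans (isT : 0 < 2)%N n2).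
(* Once the second eigenvalue is subtracted from all of them, only the first term can be positive,
   and its weight is at most 1. *)
have -> : E 0%N + t * E 1%N = E 0%N - E 1%N + \sum_i E 1%N * w i.
  by rewrite -mulr_sumr sw; ring.
rewrite -lerBlDr -sumrB (bigD1 i0) //= -[leRHS]addr0 lerD //.
  rewrite mxE -mulrBl -[leRHS]mulr1 ler_wpM2l ?subr_ge0 //.
  by have /andP[] := wi i0.
apply: sumr_le0 => i ni0; rewrite mxE -mulrBl mulr_le0_ge0 //; last first.
  by have /andP[] := wi i.
rewrite subr_le0 Ei // lt0n; apply: contra ni0 => /eqP i0'.
by apply/eqP/val_inj.
Qed.

Lemma bf_delta (R : pzRingType) (n : nat) (A : 'M[R]_n) (i j : 'I_n) :
  bf A (delta_mx 0 i) (delta_mx 0 j) = A i j.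
Proof.
by rewrite /bf -rowE trmx_delta -colE !mxE.
Qed.

Lemma bfDl (R : pzRingType) (n : nat) (A : 'M[R]_n) (x y z : 'rV[R]_n) :
  bf A (x + y) z = bf A x z + bf A y z.
Proof. by rewrite /bf !mulmxDl mxE. Qed.

Lemma bfDr (R : pzRingType) (n : nat) (A : 'M[R]_n) (x y z : 'rV[R]_n) :
  bf A x (y + z) = bf A x y + bf A x z.
Proof. by rewrite /bf linearD /= mulmxDr mxE. Qed.

Lemma bfZl (R : comPzRingType) (n : nat) (A : 'M[R]_n) a (x y : 'rV[R]_n) :
  bf A (a *: x) y = a * bf A x y.
Proof. by rewrite /bf -!scalemxAl mxE. Qed.

Lemma bfZr (R : comPzRingType) (n : nat) (A : 'M[R]_n) a (x y : 'rV[R]_n) :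
  bf A x (a *: y) = a * bf A x y.
Proof. by rewrite /bf linearZ /= -scalemxAr mxE. Qed.

(** * Matrices with P^2 <= P *)

Section Contraction.
Variables (R : realFieldType) (n : nat) (P : 'M[R]_n).
Hypothesis (cP : contraction P).

Lemma contraction_sym i j : P i j = P j i.
Proof. by rewrite -[in LHS]cP.1 mxE. Qed.

Lemma contraction_row i : \sum_j P i j ^+ 2 <= P i i.
Proof.
have := cP.2 (delta_mx 0 i); rewrite bf_delta; apply: le_trans.
by rewrite -rowE; apply: ler_sum => j _; rewrite mxE.
Qed.

Lemma contraction_row2 i k :
  \sum_j (P i j + P k j) ^+ 2 <= P i i + P k k + 2 * P i k.
Proof.
have := cP.2 (delta_mx 0 i + delta_mx 0 k).
rewrite bfDl !bfDr !bf_delta (contraction_sym k i).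
have -> : P i i + P i k + (P i k + P k k) = P i i + P k k + 2 * P i k by ring.
apply: le_trans.
by rewrite mulmxDl -!rowE; apply: ler_sum => j _; rewrite !mxE.
Qed.

Lemma contraction_diag_ge0 i : 0 <= P i i.
Proof.
by apply: le_trans (contraction_row i); apply: sumr_ge0 => j _; apply: sqr_ge0.
Qed.

Lemma contraction_diag_le1 i : P i i <= 1.
Proof.
have : P i i ^+ 2 <= P i i.
  apply: le_trans (contraction_row i); rewrite (bigD1 i) //= lerDl.
  by apply: sumr_ge0 => j _; apply: sqr_ge0.
by have := contraction_diag_ge0 i; nra.
Qed.

(** Expand |z P - z|^2 >= 0 and use |z P|^2 <= z P z^T. *)
Lemma contraction_le_sqnorm z : bf P z z <= sqnorm z.
Proof.
have := sqnorm_ge0 (z *m P - z); have := cP.2 z.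
have -> : sqnorm (z *m P - z) = sqnorm (z *m P) - 2 * bf P z z + sqnorm z.
  have bE : bf P z z = \sum_i (z *m P) ord0 i * z ord0 i.
    by rewrite /bf mxE; apply: eq_bigr => i _; rewrite [z^T _ _]mxE.
  rewrite bE mulr_sumr /sqnorm -sumrB -big_split /=.
  by apply: eq_bigr => i _; rewrite mxE [(- z) _ _]mxE; ring.
by lra.
Qed.

Lemma contraction_ge0 z : 0 <= bf P z z.
Proof. by apply: le_trans (cP.2 z); apply: sqnorm_ge0. Qed.

(** The left side is the form of P at a sum of two basis vectors. It is also the contribution of an
    edge ij to the trace. *)
Lemma contraction_pair_le i j : i != j -> P i i + P j j + 2 * P i j <= 2.
Proof.
move=> nij; have := contraction_le_sqnorm (delta_mx 0 i + delta_mx 0 j).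
rewrite bfDl !bfDr !bf_delta (contraction_sym j i).
have -> : sqnorm (delta_mx 0 i + delta_mx 0 j : 'rV[R]_n) = 2.
  rewrite /sqnorm (bigD1 i) //= (bigD1 j) /=; last by rewrite eq_sym.
  rewrite big1 => [|k /andP[/negPf ki /negPf kj]].
    rewrite !mxE !eqxx (negPf nij) [j == i]eq_sym (negPf nij) /=.
    by rewrite !mulr1n !mulr0n; ring.
  by rewrite !mxE ki kj !andbF addr0 expr0n.
by lra.
Qed.

Lemma contraction_frobenius : \sum_i \sum_j P i j ^+ 2 <= \tr P.
Proof. by apply: ler_sum => i _; apply: contraction_row. Qed.

End Contraction.

(** * Degrees and vertex deletion *)

Section Graph.
Variable n : nat.
Implicit Types (e : rel 'I_n) (v : 'I_n).

Definition deg e (i : 'I_n) : nat := (\sum_j e i j)%N.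
Definition esize e : nat :=
  (\sum_(i < n) \sum_(j < n | i < j) e i j)%N.
Definition deg_sq e : nat := (\sum_i deg e i ^ 2)%N.
Definition supp_size e : nat := (\sum_i (0 < deg e i))%N.
(** The vertex stays as an isolated one, so that all graphs of the induction share one index set and
    their matrices one size. *)
Definition del e v : rel 'I_n := fun i j => [&& e i j, i != v & j != v].

Lemma del_sym e v : symmetric e -> symmetric (del e v).
Proof. by move=> es i j; rewrite /del es [(i != v) && _]andbC. Qed.

Lemma del_irr e v : irreflexive e -> irreflexive (del e v).
Proof. by move=> ei i; rewrite /del ei. Qed.

Lemma sum_deg e : symmetric e -> irreflexive e ->
  (\sum_i deg e i = 2 * esize e)%N.
Proof.
move=> es ei; rewrite mul2n -addnn {1}/esize.
have -> : (\sum_(i < n) \sum_(j < n | i < j) e i j =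
           \sum_(i < n) \sum_(j < n | j < i) e i j)%N.
  rewrite (exchange_big_dep xpredT) //=; apply: eq_bigr => i _.
  by apply: eq_bigr => j _; rewrite es.
rewrite /esize -big_split; apply: eq_bigr => i _.
rewrite /deg (bigID (fun j : 'I_n => j < i)%N) /=; congr (_ + _)%N.
rewrite (bigD1 i) ?ltnn //= ei add0n; apply: eq_bigl => j.
by rewrite -leqNgt ltn_neqAle andbC eq_sym.
Qed.

Lemma deg_del e v i : irreflexive e -> symmetric e ->
  i != v -> deg e i = (deg (del e v) i + e v i)%N.
Proof.
move=> ei es niv; rewrite /deg (bigD1 v) //= addnC es; congr (_ + _)%N.
rewrite [RHS](bigD1 v) //= /del eqxx !andbF add0n.
by apply: eq_bigr => j njv; rewrite niv njv !andbT.
Qed.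

Lemma deg_delv e v : deg (del e v) v = 0%N.
Proof. by apply: big1 => j _; rewrite /del eqxx andbF. Qed.

Lemma esize_del e v : symmetric e -> irreflexive e ->
  esize e = (deg e v + esize (del e v))%N.
Proof.
move=> es ei; apply/eqP; rewrite -(eqn_pmul2l (isT : 0 < 2)%N) mulnDr.
rewrite -!sum_deg //; try exact: del_sym; try exact: del_irr.
rewrite (bigD1 v) //= [X in (_ + X)%N == _](eq_bigr
  (fun i => (deg (del e v) i + e v i)%N)) => [|i ni]; last exact: deg_del.
rewrite big_split /= [X in _ == (_ + X)%N](bigD1 v) //= deg_delv add0n.
have -> : (\sum_(i | i != v) e v i = deg e v)%N.
  by rewrite /deg [RHS](bigD1 v) //= ei.
by apply/eqP; lia.
Qed.

Definition nbr_deg e v : nat := (\sum_j e v j * deg (del e v) j)%N.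

(** A neighbour of v of remaining degree x contributes (x + 1)^2 = x^2 + 1 + 2 x. *)
Lemma deg_sq_del e v : symmetric e -> irreflexive e ->
  deg_sq e =
    (deg e v ^ 2 + deg e v + deg_sq (del e v) + 2 * nbr_deg e v)%N.
Proof.
move=> es ei; rewrite /deg_sq (bigD1 v) //=.
rewrite (eq_bigr (fun i => (deg (del e v) i ^ 2 + e v i + 2 * (e v i * deg
    (del e v) i)))%N) => [|i ni]; last first.
  by rewrite (deg_del ei es ni); case: (e v i) => /=; nia.
rewrite !big_split /= [X in _ = (_ + X + _)%N](bigD1 v) //= deg_delv.
rewrite /nbr_deg [X in _ = (_ + 2 * X)%N](bigD1 v) //= ei mul0n.
rewrite [X in (_ + (_ + (_ + (_ + X))))%N]big1 //.
have -> : (\sum_(i | i != v) e v i = deg e v)%N.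
  by rewrite /deg [RHS](bigD1 v) //= ei.
by lia.
Qed.

(** At a neighbour of v of remaining degree x both sides count 1 + x; at any other vertex the left
    side counts at most 1, and only if x > 0. Bounding the support jointly with [nbr_deg] absorbs
    the cross term of [deg_sq_del]. *)
Lemma supp_size_del e v : symmetric e -> irreflexive e ->
  (supp_size e + nbr_deg e v <= 1 + deg e v + 2 * esize (del e v))%N.
Proof.
move=> es ei; rewrite -sum_deg; try exact: del_sym; try exact: del_irr.
rewrite /supp_size /nbr_deg /deg -/(deg e) (bigD1 v) //=.
rewrite -[X in (_ <= _ + X + _)%N]/(deg e v).
have -> : deg e v = (\sum_(i | i != v) e v i)%N.
  by rewrite /deg [LHS](bigD1 v) //= ei.
rewrite [X in (_ + X <= _)%N](bigD1 v) //= ei mul0n add0n.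
rewrite [X in (_ <= _ + X)%N](bigD1 v) //=.
rewrite -/(deg (del e v) v) deg_delv add0n -!addnA leq_add ?leq_b1 //.
rewrite -!big_split; apply: leq_sum => i ni.
rewrite -/(deg e i) -/(deg (del e v) i) (deg_del ei es ni).
by case: (e v i) => /=; case: (deg _ _) => /= *; lia.
Qed.

End Graph.

(** * The trace of P Q *)

Section Energy.
Variables (R : realType) (n : nat).
Implicit Types (e : rel 'I_n) (v : 'I_n) (P : 'M[R]_n).

Definition qmx e : 'M[R]_n :=
  \matrix_(i, j) ((deg e i)%:R * (i == j)%:R + (e i j)%:R).

(** The sum runs over ordered pairs, so for symmetric P an edge ij contributes P_ii + P_jj + 2
    P_ij. *)
Definition energy e P : R := \sum_i \sum_j (e i j)%:R * (P i i + P i j).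

Lemma sum_pred1r (i : 'I_n) (F : 'I_n -> R) :
  \sum_j (i == j)%:R * F j = F i.
Proof.
rewrite (bigD1 i) //= eqxx mul1r big1 ?addr0 // => j nji.
by rewrite eq_sym (negPf nji) mul0r.
Qed.

Lemma natr_deg e i : (deg e i)%:R = \sum_j (e i j)%:R :> R.
Proof. exact: natr_sum. Qed.

Lemma qmx_sym e : symmetric e -> (qmx e)^T = qmx e.
Proof.
move=> es; apply/matrixP => i j; rewrite !mxE es eq_sym.
by case: eqP => [->|]; rewrite ?mulr0.
Qed.

Lemma qmx_sum e (F : 'I_n -> 'I_n -> R) :
  \sum_i \sum_j F i j * qmx e i j =
  \sum_i \sum_j (e i j)%:R * (F i i + F i j).
Proof.
apply: eq_bigr => i _.
rewrite (eq_bigr (fun j => (i == j)%:R * (F i j * (deg e i)%:R) + (e i j)%:R *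
    F i j)).
  rewrite big_split /= sum_pred1r natr_deg mulr_sumr -big_split /=.
  by apply: eq_bigr => j _; ring.
by move=> j _; rewrite mxE; ring.
Qed.

Lemma mxtrace_qmx e P : symmetric e -> P^T = P ->
  \tr (P *m qmx e) = energy e P.
Proof.
move=> es sP; rewrite /energy -qmx_sum /mxtrace; apply: eq_bigr => i _.
rewrite mxE; apply: eq_bigr => j _.
by rewrite -[in qmx e j i](qmx_sym es) [in LHS]mxE.
Qed.

Lemma bf_qmx e (z : 'rV[R]_n) :
  bf (qmx e) z z =
  \sum_i \sum_j (e i j)%:R * (z ord0 i ^+ 2 + z ord0 i * z ord0 j).
Proof.
rewrite bfE (eq_bigr (fun i => \sum_j (z ord0 i * z ord0 j) * qmx e i j)).
  by rewrite qmx_sum.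
by move=> i _; apply: eq_bigr => j _; ring.
Qed.

Lemma deg_gt0 e i j : e i j -> (0 < deg e i)%N.
Proof. by move=> eij; rewrite /deg (bigD1 j) //= eij. Qed.

(** For an eigenvector z, AM-GM with the degrees as weights gives 2 z_i z_j <= z_i^2 d_j / d_i +
    z_j^2 d_i / d_j on each edge. Collecting the terms in z_i^2 leaves the degree of i plus the mean
    degree of its neighbours. *)
Lemma top_eigenvalue_le e (b : R) :
    symmetric e -> (0 < n)%N -> 0 <= b ->
    (forall i, (0 < deg e i)%N ->
       (deg e i ^ 2 + \sum_j e i j * deg e j)%N%:R <= b * (deg e i)%:R) ->
  (eigenvalues (qmx e))`_0 <= b.
Proof.
move=> es n0 b0 Hb; set E0 := _`_0.
have sQ := qmx_sym es.
have /eigenvalueP[z zE z0] : eigenvalue (qmx e) E0.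
  rewrite eigenvalue_root_char (char_poly_eigenvalues sQ).
  by rewrite root_prod_XsubC mem_nth // size_eigenvalues.
have zz : 0 < sqnorm z.
  rewrite lt_def sqnorm_ge0 andbT psumr_eq0 => [|i _]; last exact: sqr_ge0.
  apply: contra z0 => /allP z0; apply/eqP/rowP => i; rewrite mxE.
  by have := z0 i; rewrite mem_index_enum /= sqrf_eq0 => /(_ isT)/eqP.
have : E0 * sqnorm z = bf (qmx e) z z.
  by rewrite /bf zE -scalemxAl mxE sqnormE.
suff : bf (qmx e) z z <= b * sqnorm z by move=> bfle zEE; move: bfle; rewrite
    -zEE ler_pM2r.
pose d i : R := (deg e i)%:R; pose x i := z ord0 i.
rewrite bf_qmx.
have step i j : (e i j)%:R * (x i ^+ 2 + x i * x j) <=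
   (e i j)%:R * (x i ^+ 2 * (1 + d j / d i / 2)) +
   (e i j)%:R * (x j ^+ 2 * (d i / d j / 2)).
  case eij : (e i j); rewrite ?mul0r ?addr0 // !mul1r.
  have di : 0 < d i by rewrite ltr0n (deg_gt0 eij).
  have dj : 0 < d j by rewrite ltr0n; apply: (@deg_gt0 _ _ i); rewrite es.
  rewrite -subr_ge0.
  have -> : x i ^+ 2 * (1 + d j / d i / 2) + x j ^+ 2 * (d i / d j / 2)
            - (x i ^+ 2 + x i * x j) =
            (x i * d j - x j * d i) ^+ 2 / (2 * (d i * d j)).
    by field; rewrite !gt_eqF.
  by rewrite divr_ge0 ?sqr_ge0 // mulr_ge0 // mulr_ge0 ?ltW.
apply: le_trans (ler_sum _ (fun i _ => ler_sum _ (fun j _ => step i j))) _.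
rewrite (eq_bigr (fun i => \sum_j (e i j)%:R * (x i ^+ 2 * (1 + d j / d i /
    2)) + \sum_j (e i j)%:R * (x j ^+ 2 * (d i / d j / 2)))); last first.
  by move=> i _; rewrite big_split.
rewrite big_split /= [X in _ + X]exchange_big /= -big_split /= mulr_sumr.
apply: ler_sum => i _; rewrite -big_split /=.
rewrite (eq_bigr (fun j => x i ^+ 2 * ((e i j)%:R * (1 + d j / d i)))); last
    first.
  by move=> j _; rewrite [e j i]es; set r := d j / d i; field.
rewrite -mulr_sumr mulrC ler_wpM2r ?sqr_ge0 //.
(* At an isolated vertex the quotient by [d i] carries no information, but the row is empty and [b0]
   suffices. *)
have [di0|di] := posnP (deg e i).
  rewrite big1 // => j _; case eij : (e i j); rewrite ?mul0r //.
  by move: (deg_gt0 eij); rewrite di0.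
have dp : 0 < d i by rewrite ltr0n.
rewrite -(ler_pM2r dp) mulr_suml; apply: le_trans (Hb i di).
rewrite natrD natrX natr_sum -/(d i) expr2.
have -> : d i * d i = \sum_j (e i j)%:R * d i by rewrite -mulr_suml -natr_deg.
rewrite -big_split /=.
apply: ler_sum => j _; rewrite natrM -/(d j) le_eqVlt; apply/orP; left.
by apply/eqP; field; rewrite gt_eqF.
Qed.

Lemma energy_del e v P : symmetric e -> irreflexive e -> P^T = P ->
  energy e P =
    \sum_j (e v j)%:R * (P v v + P j j + 2 * P v j) + energy (del e v) P.
Proof.
move=> es ei sP; have Ps i j : P i j = P j i by rewrite -[in LHS]sP mxE.
rewrite /energy (bigD1 v) //= [X in _ = _ + X](bigD1 v) //=.
rewrite [X in _ = _ + (X + _)]big1 => [|j _]; last first.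
  by rewrite /del eqxx andbF mul0r.
rewrite add0r.
rewrite [X in _ + X = _](eq_bigr (fun i => (e v i)%:R * (P i i + P v i) +
    \sum_j (del e v i j)%:R * (P i i + P i j))); last first.
  move=> i niv; rewrite (bigD1 v) //= es (Ps i v); congr (_ + _).
  rewrite [RHS](bigD1 v) //= /del eqxx !andbF mul0r add0r.
  by apply: eq_bigr => j njv; rewrite niv njv !andbT.
rewrite big_split /= addrA; congr (_ + _).
rewrite [X in _ + X](_ : _ = \sum_i (e v i)%:R * (P i i + P v i)); last first.
  by rewrite [RHS](bigD1 v) //= ei mul0r add0r.
by rewrite -big_split /=; apply: eq_bigr => j _; ring.
Qed.

Lemma sum_diag_del P v : \sum_(j | j != v) P j j = \tr P - P v v.
Proof. by rewrite /mxtrace [in RHS](bigD1 v) //= addrAC subrr add0r. Qed.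

(** For each neighbour j, 2 P_vj <= l P_vj^2 + 1 / l. The squares off the diagonal of row v sum to
    at most P_vv - P_vv^2, and the diagonal entries of the neighbours to at most tr P - P_vv. *)
Lemma star_energy_le e v P (l : R) :
    irreflexive e -> contraction P -> 0 < l ->
  \sum_j (e v j)%:R * (P v v + P j j + 2 * P v j) <=
    (deg e v)%:R * P v v + (\tr P - P v v)
    + l * (P v v - P v v ^+ 2) + (deg e v)%:R / l.
Proof.
move=> ei cP l0; rewrite natr_deg mulr_suml mulr_suml.
have r2 : \sum_(j | j != v) P v j ^+ 2 <= P v v - P v v ^+ 2.
  by have := contraction_row cP v; rewrite (bigD1 v) //= -lerBrDl.
apply: le_trans (_ : \sum_(j | j != v) ((e v j)%:R * P v v + P j j + l * P v j
    ^+ 2 + (e v j)%:R / l) <= _).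
  rewrite (bigD1 v) //= ei mul0r add0r; apply: ler_sum => j _.
  have Pj := contraction_diag_ge0 cP j.
  case: (e v j); last first.
    by rewrite !mul0r add0r addr0 addr_ge0 // mulr_ge0 ?sqr_ge0 // ltW.
  rewrite !mul1r.
  rewrite -!addrA lerD2l lerD2l -subr_ge0.
  have -> : l * P v j ^+ 2 + l^-1 - 2 * P v j = (l * P v j - 1) ^+ 2 / l.
    by field; rewrite gt_eqF.
  by rewrite divr_ge0 ?sqr_ge0 // ltW.
rewrite !big_split /= sum_diag_del -mulr_sumr.
have sub (F : 'I_n -> R) : \sum_(j | j != v) (e v j)%:R * F j = \sum_j (e v
    j)%:R * F j.
  by rewrite [RHS](bigD1 v) //= ei mul0r add0r.
rewrite (sub (fun=> P v v)) (sub (fun=> l^-1)) lerD2r lerD2l.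
by rewrite ler_wpM2l // ltW.
Qed.

(** Zeroing row and column v of P leaves this energy unchanged. The resulting compression [W] still
    lies between 0 and 1 and has trace 1 + t, so [ky_fan_le] applies. *)
Lemma energy_del_le e v P (t : R) :
    symmetric e -> contraction P -> (2 <= n)%N -> \tr P - P v v = 1 + t ->
  energy (del e v) P <=
  (eigenvalues (qmx (del e v)))`_0 + t * (eigenvalues (qmx (del e v)))`_1.
Proof.
move=> es cP n2 trt; have hs := del_sym v es.
pose c (i : 'I_n) : R := (i != v)%:R.
pose W : 'M[R]_n := \matrix_(i, j) (c i * c j * P i j).
have WT : W^T = W.
  by apply/matrixP => i j; rewrite !mxE (contraction_sym cP) [c j * _]mulrC.
have -> : energy (del e v) P = energy (del e v) W.
  apply: eq_bigr => i _; apply: eq_bigr => j _; rewrite !mxE /c /del.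
  by case: (e i j) (i != v) (j != v) => [] [] []; rewrite /= ?mul0r // !mul1r.
rewrite -mxtrace_qmx //; apply: ky_fan_le => //; first exact: qmx_sym.
  move=> z; pose y : 'rV[R]_n := \row_i (c i * z ord0 i).
  have -> : bf W z z = bf P y y.
    rewrite !bfE; apply: eq_bigr => i _; apply: eq_bigr => j _.
    by rewrite !mxE; ring.
  rewrite contraction_ge0 //=; apply: le_trans (contraction_le_sqnorm cP y) _.
  apply: ler_sum => i _; rewrite mxE /c; case: (i == v) => /=.
    by rewrite mul0r expr0n /= sqr_ge0.
  by rewrite mul1r.
rewrite -trt -sum_diag_del /mxtrace (bigD1 v) //= mxE /c eqxx !mul0r add0r.
by apply: eq_bigr => i niv; rewrite mxE /c niv !mul1r.
Qed.

End Energy.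

(** * Cauchy-Schwarz and elimination bounds on the trace *)

Section Bounds.
Variables (R : realType) (n : nat).
Implicit Types (e : rel 'I_n) (v : 'I_n) (P : 'M[R]_n).

Lemma sum_edges_deg e (F : 'I_n -> R) :
  \sum_i \sum_j (e i j)%:R * F i = \sum_i (deg e i)%:R * F i.
Proof. by apply: eq_bigr => i _; rewrite natr_deg mulr_suml. Qed.

Lemma sum_edges_degC e (F : 'I_n -> R) : symmetric e ->
  \sum_i \sum_j (e i j)%:R * F j = \sum_i (deg e i)%:R * F i.
Proof.
move=> es; rewrite exchange_big -sum_edges_deg /=.
by apply: eq_bigr => i _; apply: eq_bigr => j _; rewrite es.
Qed.

Lemma natr_deg_sq e : (deg_sq e)%:R = \sum_i (deg e i)%:R ^+ 2 :> R.
Proof. by rewrite /deg_sq natr_sum; apply: eq_bigr => i _; rewrite natrX. Qed.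

Lemma natr_esize e : symmetric e -> irreflexive e ->
  \sum_i (deg e i)%:R = 2 * (esize e)%:R :> R.
Proof. by move=> es ei; rewrite -natr_sum sum_deg // natrM. Qed.

(** The right side is the sum of (d_i + d_j)^2 over the edges, and d_i + d_j sums to [deg_sq] over
    them. The bound says that the variance about the mean [th] is nonnegative. *)
Lemma deg_form_ge e : symmetric e -> irreflexive e -> (0 < esize e)%N ->
  (deg_sq e)%:R ^+ 2 / (esize e)%:R <=
  \sum_i \sum_j (e i j)%:R * ((deg e i)%:R * (deg e i)%:R + (deg e i)%:R *
      (deg e j)%:R) :> R.
Proof.
move=> es ei m0; set m : R := (esize e)%:R; set sg : R := (deg_sq e)%:R.
have mp : 0 < m by rewrite ltr0n.
pose d i : R := (deg e i)%:R; pose th := sg / m.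
have : 0 <= \sum_i \sum_j (e i j)%:R * (d i + d j - th) ^+ 2.
  apply: sumr_ge0 => i _; apply: sumr_ge0 => j _.
  by rewrite mulr_ge0 ?ler0n ?sqr_ge0.
pose T1 := \sum_i \sum_j (e i j)%:R * (d i ^+ 2).
pose T2 := \sum_i \sum_j (e i j)%:R * (d j ^+ 2).
pose X := \sum_i \sum_j (e i j)%:R * (d i * d j).
have T12 : T1 = T2 by rewrite /T1 /T2 sum_edges_deg sum_edges_degC.
have S1 : \sum_i \sum_j (e i j)%:R * d i = sg.
  rewrite sum_edges_deg /sg natr_deg_sq; apply: eq_bigr => i _.
  by rewrite expr2.
have S2 : \sum_i \sum_j (e i j)%:R * d j = sg.
  by rewrite sum_edges_degC // -S1 sum_edges_deg.
have S0 : \sum_i \sum_j (e i j)%:R * 1 = 2 * m.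
  by rewrite sum_edges_deg -natr_esize //; apply: eq_bigr => i _; rewrite mulr1.
have -> : \sum_i \sum_j (e i j)%:R * (d i + d j - th) ^+ 2 =
   T1 + T2 + 2 * X - 2 * th * sg - 2 * th * sg + th ^+ 2 * (2 * m).
  rewrite -S0 -{1}S1 -S2 /T1 /T2 /X !mulr_sumr -!big_split /= -!sumrB
      -!big_split /=.
  apply: eq_bigr => i _; rewrite !mulr_sumr -!big_split /= -!sumrB -!big_split
      /=.
  by apply: eq_bigr => j _; ring.
have -> : \sum_i \sum_j (e i j)%:R * (d i * d i + d i * d j) = T1 + X.
  rewrite /T1 /X -big_split; apply: eq_bigr => i _ /=; rewrite -big_split /=.
  by apply: eq_bigr => j _; ring.
have -> : sg ^+ 2 / m = th * sg by rewrite /th; field; rewrite gt_eqF.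
have : th ^+ 2 * m = th * sg by rewrite /th; field; rewrite gt_eqF.
by rewrite -T12; nra.
Qed.

(* Cauchy-Schwarz in the Frobenius norm for P and Q - c I - (g / |d|^2) d^T d,
   where I is the identity on the non-isolated vertices and d the degree vector:
   P has norm at most sqrt 2, and the two subtracted terms contribute at most
   2 c and g to the trace. *)
Lemma energy_trace_le e P (g c l : R) :
    symmetric e -> irreflexive e -> contraction P -> \tr P = 2 ->
    (0 < esize e)%N -> 0 <= g -> 0 <= c -> 0 < l ->
  energy e P <= g + 2 * c + l +
    ((deg_sq e)%:R * (1 - 2 * g / (esize e)%:R) + c ^+ 2 * (supp_size e)%:R
     + 2 * (esize e)%:R + g ^+ 2 - 4 * c * (esize e)%:R + 2 * c * g) / (2 * l).
Proof.
move=> es ei cP trP m0 g0 c0 l0.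
set m : R := (esize e)%:R; set sg : R := (deg_sq e)%:R.
have mp : 0 < m by rewrite ltr0n.
have sgp : 0 < sg.
  rewrite ltr0n lt0n; apply: contraL m0 => /eqP s0; rewrite -leqNgt.
  rewrite -(leq_pmul2l (isT : 0 < 2)%N) -sum_deg // muln0 leqn0 sum_nat_eq0.
  move/eqP: s0; rewrite sum_nat_eq0 => /forallP H.
  by apply/forallP => i; move: (H i); rewrite expn_eq0 andbT.
pose d i : R := (deg e i)%:R; pose s i : R := (0 < deg e i)%:R.
pose h := g / sg.
pose q i j := qmx R e i j.
pose X i j := q i j - c * ((i == j)%:R * s i) - h * (d i * d j).
have sE i : s i * s i = s i by rewrite /s; case: (0 < _)%N; rewrite ?mulr0
    ?mulr1.
have sd i : s i * d i = d i.
  by rewrite /s /d; case: (deg e i) => [|k]; rewrite ?mulr0 ?mul1r.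
have dsg : \sum_i d i ^+ 2 = sg by rewrite /sg natr_deg_sq.
have energyE : energy e P = \sum_i \sum_j P i j * X i j
    + c * \sum_i s i * P i i + h * bf P (\row_i d i) (\row_i d i).
  rewrite /energy -qmx_sum bfE !mulr_sumr -!big_split /=.
  apply: eq_bigr => i _; rewrite mulr_sumr -(sum_pred1r i (fun j => c * (s i *
      P i j))).
  rewrite -!big_split /=; apply: eq_bigr => j _; rewrite !mxE /X /q !mxE -/(d
      i).
  by ring.
have b1 : c * \sum_i s i * P i i <= 2 * c.
  rewrite [2 * c]mulrC ler_wpM2l // -trP; apply: ler_sum => i _.
  rewrite /s; case: (0 < _)%N; rewrite ?mul1r // mul0r.
  exact: contraction_diag_ge0.
have h0 : 0 <= h by rewrite divr_ge0 // ltW.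
have b2 : h * bf P (\row_i d i) (\row_i d i) <= g.
  have -> : g = h * sg by rewrite /h mulfVK // gt_eqF.
  rewrite ler_wpM2l //; apply: le_trans (contraction_le_sqnorm cP _) _.
  by rewrite -dsg /sqnorm; apply: ler_sum => i _; rewrite mxE.
(* Cauchy-Schwarz is used entrywise with the parameter l; the squared entries of P sum to at most
   2. *)
have b3 : \sum_i \sum_j P i j * X i j <=
    l + (\sum_i \sum_j X i j ^+ 2) / (2 * l).
  have pw i j : P i j * X i j <= l / 2 * P i j ^+ 2 + (2 * l)^-1 * X i j ^+ 2.
    rewrite -subr_ge0.
    have -> : l / 2 * P i j ^+ 2 + (2 * l)^-1 * X i j ^+ 2 - P i j * X i j =
      (l * P i j - X i j) ^+ 2 / (2 * l) by field; rewrite gt_eqF.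
    by rewrite divr_ge0 ?sqr_ge0 // mulr_ge0 // ltW.
  apply: le_trans (ler_sum _ (fun i _ => ler_sum _ (fun j _ => pw i j))) _.
  rewrite (eq_bigr (fun i => l / 2 * \sum_j P i j ^+ 2 + (2 * l)^-1 * \sum_j X
      i j ^+ 2)); last first.
    by move=> i _; rewrite !mulr_sumr big_split.
  rewrite big_split /= -!mulr_sumr [X in _ <= l + X]mulrC lerD2r.
  have := contraction_frobenius cP; rewrite trP => fr.
  rewrite [leRHS](_ : l = l / 2 * 2); last by field.
  by rewrite ler_wpM2l // divr_ge0 // ltW.
have qE i j : q i j = d i * (i == j)%:R + (e i j)%:R by rewrite /q mxE.
have q2 : \sum_i \sum_j q i j ^+ 2 = sg + 2 * m.
  rewrite -dsg -natr_esize // -big_split; apply: eq_bigr => i _ /=.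
  rewrite -(sum_pred1r i (fun=> d i ^+ 2)) natr_deg -big_split.
  apply: eq_bigr => j _; rewrite qE /=; have [<-|] := eqVneq i j.
    by rewrite ei mulr1 addr0 mul1r addr0.
  by move=> _; rewrite mulr0 add0r mul0r add0r; case: (e i j); rewrite ?expr1n
      ?expr0n.
have XX : \sum_i \sum_j X i j ^+ 2 <=
  sg * (1 - 2 * g / m) + c ^+ 2 * (supp_size e)%:R
     + 2 * m + g ^+ 2 - 4 * c * m + 2 * c * g.
  (* [Y] is the only term of the expansion that is estimated; it enters with a negative sign, so a
     lower bound is what is needed. *)
  pose Y := \sum_i \sum_j d i * d j * q i j.
  have YE : sg ^+ 2 / m <= Y by rewrite /Y qmx_sum; apply: deg_form_ge.
  have -> : \sum_i \sum_j X i j ^+ 2 = (\sum_i \sum_j q i j ^+ 2)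
    + c ^+ 2 * (\sum_i s i) + h ^+ 2 * (\sum_i d i ^+ 2 * (\sum_j d j ^+ 2))
    - 2 * c * (\sum_i d i) - 2 * h * Y + 2 * c * h * (\sum_i d i ^+ 2).
    rewrite /Y !mulr_sumr -!big_split /= -!sumrB -!big_split /=.
    apply: eq_bigr => i _.
    rewrite -(sum_pred1r i (fun=> c ^+ 2 * s i)).
    rewrite -(sum_pred1r i (fun=> 2 * c * d i)).
    rewrite -(sum_pred1r i (fun=> 2 * c * h * d i ^+ 2)).
    rewrite !mulr_sumr -!big_split /= -!sumrB -!big_split /=.
    apply: eq_bigr => j _; rewrite /X qE; have [<-|nij] := eqVneq i j.
      rewrite ei mulr1 !mul1r addr0; have := sE i; have := sd i.
      set a := s i; set b := d i => ab aa.
      rewrite -[c ^+ 2 * a]/(c ^+ 2 * a).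
      have -> : c ^+ 2 * a = c ^+ 2 * (a * a) by rewrite aa.
      have -> : 2 * c * b = 2 * c * (a * b) by rewrite ab.
      have -> : 2 * c * h * b ^+ 2 = 2 * c * h * ((a * b) * b) by rewrite ab
          expr2.
      by ring.
    by rewrite !mul0r !mulr0; ring.
  rewrite q2 -/d dsg -mulr_suml dsg natr_esize // -/m.
  have -> : \sum_i s i = (supp_size e)%:R by rewrite /supp_size natr_sum.
  have hg : h * sg = g by rewrite /h mulfVK // gt_eqF.
  have -> : h ^+ 2 * (sg * sg) = g ^+ 2 by rewrite -hg; ring.
  have -> : 2 * c * h * sg = 2 * c * g by rewrite -hg; ring.
  have : h * (sg ^+ 2 / m) <= h * Y by rewrite ler_wpM2l.
  have -> : h * (sg ^+ 2 / m) = g * sg / m by rewrite -hg; ring.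
  have -> : g * sg / m = sg * (g / m) by ring.
  have -> : 2 * g / m = 2 * (g / m) by ring.
  by set r := g / m => hY; nra.
rewrite energyE; apply: le_trans (lerD (lerD b3 b1) b2) _.
have : (\sum_i \sum_j X i j ^+ 2) / (2 * l) <= (sg * (1 - 2 * g / m) + c ^+ 2
    * (supp_size e)%:R + 2 * m + g ^+ 2 - 4 * c * m + 2 * c * g) / (2 * l).
  by rewrite ler_pM2r // invr_gt0 mulr_gt0.
by set A := _ / (2 * l); set B := _ / (2 * l); lra.
Qed.

(** The star bound and the Ky Fan bound add up to a quadratic in p = P_vv. The value l = k + 3 - mu
    - x is the optimal parameter: with a = k + 1 - x, the slack is (l p - a)^2 / l + ((2 - mu) a -
    k) / l. *)
Lemma energy_elim_le e v P (mu x : R) (k := (deg e v)%:R : R)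
    (c := (esize (del e v))%:R : R) (E := eigenvalues (qmx R (del e v))) :
    symmetric e -> irreflexive e -> contraction P -> \tr P = 2 -> (2 <= n)%N ->
    E`_0 <= c + mu -> E`_0 + E`_1 <= c + x ->
    0 < k + 3 - mu - x -> k <= (2 - mu) * (k + 1 - x) ->
  energy e P <= (esize e)%:R + 3.
Proof.
move=> es ei cP trP n2 E0 E1 l0 hk; rewrite (esize_del v es ei) natrD -/k -/c.
rewrite (energy_del v es ei cP.1); set p := P v v.
have p0 : 0 <= p := contraction_diag_ge0 cP v.
have p1 : p <= 1 := contraction_diag_le1 cP v.
have Hs := star_energy_le v ei cP l0; rewrite trP -/k -/p in Hs.
have Hd : energy (del e v) P <= E`_0 + (1 - p) * E`_1.
  by apply: energy_del_le => //; rewrite trP -/p; ring.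
(* The bound on q_1 is used with weight p and the bound on q_1 + q_2 with weight 1 - p. *)
have : E`_0 + (1 - p) * E`_1 <= p * (c + mu) + (1 - p) * (c + x).
  have -> : E`_0 + (1 - p) * E`_1 = p * E`_0 + (1 - p) * (E`_0 + E`_1) by ring.
  by rewrite lerD // ler_wpM2l // subr_ge0.
move: Hs Hd; set l := k + 3 - mu - x in l0 *.
set S := \sum_j _; set T := energy _ _; set U := E`_0 + _ => Hs Hd HU.
have kl : k / l <= (2 - mu) * (k + 1 - x) / l by rewrite ler_pM2r // invr_gt0.
have sq : 0 <= (l * p - (k + 1 - x)) ^+ 2 / l by rewrite divr_ge0 ?sqr_ge0 //
    ltW.
have sqE : (l * p - (k + 1 - x)) ^+ 2 / l =
  l * p ^+ 2 - 2 * p * (k + 1 - x) + (k + 1 - x) - (2 - mu) * (k + 1 - x) / l.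
  by rewrite /l; field; rewrite gt_eqF.
have lpE : l * p = (k + 3 - mu - x) * p by [].
by move: Hs sqE sq kl lpE; rewrite -/p; clearbody l; nra.
Qed.

End Bounds.

(** * Graphs with two centers, and stars with a triangle *)

Section Families.
Variables (R : realType) (n : nat).
Implicit Types (e : rel 'I_n) (u v : 'I_n) (P : 'M[R]_n).

Lemma energy_le_double e P : symmetric e -> irreflexive e -> contraction P ->
  energy e P <= 2 * (esize e)%:R.
Proof.
move=> es ei cP; have Ps := contraction_sym cP.
have H : 2 * energy e P =
    \sum_i \sum_j (e i j)%:R * (P i i + P j j + 2 * P i j).
  have E1 : energy e P = \sum_i \sum_j (e i j)%:R * (P j j + P i j).
    rewrite /energy exchange_big; apply: eq_bigr => i _; apply: eq_bigr => j _.
    by rewrite [e j i]es [P j i]Ps.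
  rewrite mulrDl mul1r {2}E1 /energy -big_split; apply: eq_bigr => i _ /=.
  by rewrite -big_split; apply: eq_bigr => j _ /=; ring.
rewrite -(ler_pM2l (ltr0Sn R 1)) H -natr_esize // mulr_sumr.
apply: ler_sum => i _; rewrite natr_deg mulr_sumr; apply: ler_sum => j _.
have [eij|_] := boolP (e i j); last by rewrite mul0r mulr0.
rewrite mul1r mulr1; apply: contraction_pair_le => //.
by apply: contraL eij => /eqP ->; rewrite ei.
Qed.

(** In [star_energy_le], l = k + 1 turns the slack into a square. *)
Lemma energy_star_le e v P : symmetric e -> irreflexive e -> contraction P ->
    \tr P = 2 ->
  energy e P <= (deg e v)%:R + 2 + energy (del e v) P.
Proof.
move=> es ei cP trP; rewrite (energy_del v es ei cP.1) lerD2r.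
have l0 : 0 < (deg e v)%:R + 1 :> R by rewrite ltr_wpDl ?ler0n.
apply: le_trans (star_energy_le v ei cP l0) _; rewrite trP.
set k := (deg e v)%:R in l0 *; set p := P v v.
rewrite -subr_ge0.
have -> : k + 2 - (k * p + (2 - p) + (k + 1) * (p - p ^+ 2) + k / (k + 1)) =
   ((k + 1) * (1 - p) - 1) ^+ 2 / (k + 1) by field; rewrite gt_eqF.
by rewrite divr_ge0 ?sqr_ge0 // ltW.
Qed.

Lemma weighted_amgm (l a x : R) : 0 < l -> a ^+ 2 = a -> 2 * (a * x) <= l * x
    ^+ 2 + a / l.
Proof.
move=> l0 aa; rewrite -subr_ge0.
have -> : l * x ^+ 2 + a / l - 2 * (a * x) = (l * x - a) ^+ 2 / l.
  by rewrite -{1}aa; field; rewrite gt_eqF.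
by rewrite divr_ge0 ?sqr_ge0 // ltW.
Qed.

Lemma natr_bool_sqr (b : bool) : (b%:R : R) ^+ 2 = b%:R.
Proof. by case: b; rewrite ?expr1n ?expr0n. Qed.

(** All edges meet u or v, so apart from the diagonal only rows u and v of P occur. The cases are: u
    and v not adjacent, adjacent without a common neighbour, adjacent with one. Only the last needs
    the joint bound [contraction_row2]. *)
Lemma energy_two_centers_le e u v P :
    symmetric e -> irreflexive e -> contraction P -> \tr P = 2 ->
    (3 <= deg e v)%N -> (2 <= deg (del e v) u)%N ->
    esize (del e v) = deg (del e v) u ->
  energy e P <= (esize e)%:R + 3.
Proof.
move=> es ei cP trP kv3 ku2 HE.
have nuv : u != v.
  by apply: contraL ku2 => /eqP ->; rewrite deg_delv.
set h := del e v in ku2 HE *.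
have hs : symmetric h := del_sym v es; have hi : irreflexive h := del_irr v ei.
have Ps := contraction_sym cP.
have e0 : energy (del h u) P <= 0.
  have := energy_le_double (del_sym u hs) (del_irr u hi) cP.
  by move: (esize_del u hs hi); rewrite HE => /eqP; rewrite -[X in X ==
      _]addn0 eqn_add2l => /eqP <-; rewrite mulr0.
rewrite (esize_del v es ei) HE (energy_del v es ei cP.1) -/h (energy_del u hs
    hi cP.1).
pose f j := (j != v) && (j != u).
pose a j : R := (e v j)%:R; pose b j : R := (h u j)%:R; pose d := a u.
have aa j : a j ^+ 2 = a j := natr_bool_sqr _.
have bb j : b j ^+ 2 = b j := natr_bool_sqr _.
have a0 j : 0 <= a j := ler0n _ _.
have b0 j : 0 <= b j := ler0n _ _.
have a1 j : a j <= 1 by rewrite /a lern1 leq_b1.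
have b1 j : b j <= 1 by rewrite /b lern1 leq_b1.
have sa (F : 'I_n -> R) : \sum_j a j * F j = d * F u + \sum_(j | f j) a j * F j.
  rewrite (bigD1 v) //= {1}/a ei mul0r add0r (bigD1 u) //=.
have sb (F : 'I_n -> R) : \sum_j b j * F j = \sum_(j | f j) b j * F j.
  rewrite (bigD1 v) //= {1}/b /h /del eqxx !andbF mul0r add0r.
  by rewrite (bigD1 u) //= {1}/b hi mul0r add0r.
have sP (F : 'I_n -> R) : \sum_j F j = F v + F u + \sum_(j | f j) F j.
  by rewrite (bigD1 v) //= (bigD1 u) //= addrA.
pose p := P v v; pose q := P u u; pose g := P v u.
pose kv := \sum_(j | f j) a j; pose ku := \sum_(j | f j) b j.
have dv : (deg e v)%:R = d + kv.
  rewrite natr_deg -/a (eq_bigr (fun j => a j * 1)) => [|j _]; last by rewrite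
      mulr1.
  by rewrite sa mulr1; congr (_ + _); apply: eq_bigr => j _; rewrite mulr1.
have du : (deg h u)%:R = ku.
  rewrite natr_deg -/b (eq_bigr (fun j => b j * 1)) => [|j _]; last by rewrite
      mulr1.
  by rewrite sb; apply: eq_bigr => j _; rewrite mulr1.
have s1 : \sum_(j | f j) P j j = 2 - p - q.
  by have := sP (fun j => P j j); rewrite -/(\tr P) trP -/p -/q => ->; ring.
have A2 : \sum_(j | f j) P v j ^+ 2 <= p - p ^+ 2 - g ^+ 2.
  by have := contraction_row cP v; rewrite sP -/p -/g; lra.
have B2 : \sum_(j | f j) P u j ^+ 2 <= q - q ^+ 2 - g ^+ 2.
  by have := contraction_row cP u; rewrite sP (Ps u v) -/q -/g; lra.
have C2 : \sum_(j | f j) (P v j + P u j) ^+ 2 <=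
    p + q + 2 * g - (p + g) ^+ 2 - (q + g) ^+ 2.
  have := contraction_row2 cP v u; rewrite sP (Ps u v) -/p -/q -/g.
  by rewrite [g + q]addrC; lra.
rewrite (sa (fun j => P v v + P j j + 2 * P v j)) (sb (fun j => P u u + P j j
    + 2 * P u j)).
rewrite -/p -/q -/g natrD dv du.
pose S := \sum_(j | f j) ((a j + b j) * P j j + 2 * (a j * P v j) + 2 * (b j *
    P u j)).
have -> : d * (p + q + 2 * g) + \sum_(j | f j) a j * (p + P j j + 2 * P v j) +
    (\sum_(j | f j) b j * (q + P j j + 2 * P u j) + energy (del h u) P) =
    d * (p + q + 2 * g) + kv * p + ku * q + S + energy (del h u) P.
  rewrite addrA; congr (_ + _); rewrite -!addrA; congr (_ + _).
  rewrite /kv /ku /S !mulr_suml -!big_split /=.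
  by apply: eq_bigr => j _; ring.
have ku2' : 2 <= ku by rewrite -du ler_nat.
have kv2' : 2 <= kv.
  have : 3 <= d + kv by rewrite -dv ler_nat.
  by have := a1 u; rewrite -/d; lra.
pose lv := kv + 1; pose lu := ku + 1.
have lv0 : 0 < lv by rewrite /lv; lra.
have lu0 : 0 < lu by rewrite /lu; lra.
have q0 : 0 <= q := contraction_diag_ge0 cP u.
have p0 : 0 <= p := contraction_diag_ge0 cP v.
have Pj0 j := contraction_diag_ge0 cP j.
(* Here c bounds the number of centers to which an outer vertex is joined. *)
have SumLe (c : R) : (forall j, f j -> (a j + b j) <= c) ->
    S <= c * (2 - p - q) + (lv * (p - p ^+ 2 - g ^+ 2) + kv / lv)
         + (lu * (q - q ^+ 2 - g ^+ 2) + ku / lu).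
  move=> Hc; apply: le_trans (_ : \sum_(j | f j) (c * P j j + (lv * P v j ^+ 2
      + a j / lv) + (lu * P u j ^+ 2 + b j / lu)) <= _).
    apply: ler_sum => j fj; rewrite lerD //; last exact: weighted_amgm.
    rewrite lerD //; last exact: weighted_amgm.
    by rewrite ler_wpM2r // Hc.
  rewrite !big_split /= -!mulr_sumr s1 -!mulr_suml -/kv -/ku.
  by rewrite !lerD // ler_wpM2l // ltW.
have dE : d = 0 \/ d = 1 by rewrite /d /a; case: (e v u); [right|left].
case: dE => dE.
  have Hs := SumLe 2 (fun j _ => lerD (a1 j) (b1 j)); rewrite dE mul0r !add0r.
  (* With x = 1 - p or x = 1 - q this is the share of one center in the constant 3; l >= 3 since
     each center has at least two outer neighbours. *)
  have key (l x : R) : 3 <= l -> 3 * x - l * x ^+ 2 + (l - 1) / l <= 3 / 2.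
    move=> l3; have l0 : 0 < l by lra.
    rewrite -subr_ge0.
    have -> : 3 / 2 - (3 * x - l * x ^+ 2 + (l - 1) / l) =
      ((l * x - 3 / 2) ^+ 2 + (l - 5 / 2) / 2) / l by field; rewrite gt_eqF.
    by rewrite divr_ge0 // ?(ltW l0) // addr_ge0 ?sqr_ge0 //; lra.
  have K1 := key lv (1 - p) _; have {K1} K1 := K1 ltac:(by rewrite /lv; lra).
  have K2 := key lu (1 - q) _; have {K2} K2 := K2 ltac:(by rewrite /lu; lra).
  have e1 : lv - 1 = kv by rewrite /lv; ring.
  have e2 : lu - 1 = ku by rewrite /lu; ring.
  rewrite e1 in K1; rewrite e2 in K2.
  have g2 : 0 <= (lv + lu) * g ^+ 2 by rewrite mulr_ge0 ?sqr_ge0 // addr_ge0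
      // ltW.
  have pv : lv * p = kv * p + p by rewrite /lv; ring.
  have pu : lu * q = ku * q + q by rewrite /lu; ring.
  have ev : lv = kv + 1 by []. have eu : lu = ku + 1 by [].
  clearbody lv lu; move: Hs K1 K2 g2 e0 pv pu ev eu.
  by set x1 := kv / lv; set x2 := ku / lu; set X := energy _ _; nra.
rewrite dE mul1r.
have lL : 0 < lv + lu by rewrite addr_gt0.
have [/existsP[j0 /and3P[fj0 ev0 hu0]]|none] :=
  boolP [exists j, [&& f j, e v j & h u j]]; last first.
  have {}SumLe := SumLe 1 _.
  have {SumLe} Hs : S <= 1 * (2 - p - q) + (lv * (p - p ^+ 2 - g ^+ 2) + kv /
      lv)
         + (lu * (q - q ^+ 2 - g ^+ 2) + ku / lu).
    apply: SumLe => j fj; move/existsPn/(_ j): none; rewrite fj /= /a /b.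
    by case: (e v j) (h u j) => [] [] //= _; rewrite ?addr0 ?add0r ?ler01.
  have K (l x : R) : 0 < l -> x - l * x ^+ 2 <= 1 / (4 * l).
    move=> l0; rewrite -subr_ge0.
    have -> : 1 / (4 * l) - (x - l * x ^+ 2) = (2 * l * x - 1) ^+ 2 / (4 * l).
      by field; rewrite gt_eqF.
    by rewrite divr_ge0 ?sqr_ge0 // mulr_ge0 // ltW.
  have K1 := K lv (1 - p) lv0; have K2 := K lu (1 - q) lu0.
  have K3 : 2 * g - (lv + lu) * g ^+ 2 <= 1 / (lv + lu).
    rewrite -subr_ge0.
    have -> : 1 / (lv + lu) - (2 * g - (lv + lu) * g ^+ 2) =
       ((lv + lu) * g - 1) ^+ 2 / (lv + lu) by field; rewrite gt_eqF.
    by rewrite divr_ge0 ?sqr_ge0 // ltW.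
  have K4 : 1 / (lv + lu) <= 3 / 4 * (1 / lv + 1 / lu).
    rewrite -subr_ge0.
    have -> : 3 / 4 * (1 / lv + 1 / lu) - 1 / (lv + lu) =
      (3 * (lv - lu) ^+ 2 + 8 * (lv * lu)) / (4 * (lv + lu) * lv * lu).
      by field; rewrite !gt_eqF.
    have lvlu : 0 < lv * lu by rewrite mulr_gt0.
    have den : 0 < 4 * (lv + lu) * lv * lu by rewrite !mulr_gt0.
    by rewrite divr_ge0 ?(ltW den) //; have := sqr_ge0 (lv - lu); lra.
  have e1 : kv / lv = 1 - 1 / lv by rewrite /lv; field; rewrite gt_eqF.
  have e2 : ku / lu = 1 - 1 / lu by rewrite /lu; field; rewrite gt_eqF.
  have e3 : 1 / (4 * lv) = 1 / lv / 4 by field; rewrite gt_eqF.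
  have e4 : 1 / (4 * lu) = 1 / lu / 4 by field; rewrite gt_eqF.
  rewrite e1 e2 in Hs; rewrite e3 in K1; rewrite e4 in K2.
  have pv : lv * p = kv * p + p by rewrite /lv; ring.
  have pu : lu * q = ku * q + q by rewrite /lu; ring.
  have ev : lv = kv + 1 by []. have eu : lu = ku + 1 by [].
  clear e1 e2 e3 e4; clearbody lv lu; move: Hs K1 K2 K3 K4 e0 pv pu ev eu.
  by set x1 := 1 / lv; set x2 := 1 / lu; set x3 := 1 / _; set X := energy _ _;
      nra.
(* A common neighbour exists: the estimates for rows u and v are now coupled, and [D] is the
   determinant of the coupled form. *)
pose D := lv * lu - 1; have D0 : 0 < D by rewrite /D /lv /lu; nra.
(* The last term is the value at (a j, b j) of the inverse of the matrix
   [[lv, 1], [1, lu]] of the quadratic form in (P v j, P u j). *)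
have pw j : 2 * (a j * P v j) + 2 * (b j * P u j) <=
   (P v j + P u j) ^+ 2 + kv * P v j ^+ 2 + ku * P u j ^+ 2
   + (a j * lu + b j * lv - 2 * (a j * b j)) / D.
  rewrite -subr_ge0; set x := P v j - (a j * lu - b j) / D.
  set y := P u j - (b j * lv - a j) / D.
  rewrite (_ : _ - _ = (x + y) ^+ 2 + kv * x ^+ 2 + ku * y ^+ 2).
    by rewrite !addr_ge0 ?sqr_ge0 // mulr_ge0 ?sqr_ge0 //; lra.
  rewrite /x /y.
  have Dn : lv * lu - 1 != 0 by rewrite gt_eqF.
  move: (P v j) (P u j) (a j) (b j) (aa j) (bb j) => z w s t ss tt.
  have -> : s * lu + t * lv = s ^+ 2 * lu + t ^+ 2 * lv by rewrite ss tt.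
  have -> : kv = lv - 1 by rewrite /lv; ring.
  have -> : ku = lu - 1 by rewrite /lu; ring.
  by rewrite /D; field.
(* The -2 in the last term comes from the common neighbour [j0]. *)
have Hs : S <= 2 * (2 - p - q) + (p + q + 2 * g - (p + g) ^+ 2 - (q + g) ^+ 2)
   + kv * (p - p ^+ 2 - g ^+ 2) + ku * (q - q ^+ 2 - g ^+ 2)
   + (kv * lu + ku * lv - 2) / D.
  apply: le_trans (_ : \sum_(j | f j) (2 * P j j + ((P v j + P u j) ^+ 2 + kv
      * P v j ^+ 2 + ku * P u j ^+ 2 + (a j * lu + b j * lv - 2 * (a j * b j))
      / D)) <= _).
    apply: ler_sum => j fj; rewrite -addrA lerD // ler_wpM2r //.
    by apply: lerD.
  rewrite !big_split /= -!mulr_sumr s1 -mulr_suml.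
  rewrite -!addrA lerD2l !addrA lerD //; last first.
    rewrite ler_pM2r ?invr_gt0 // sumrB big_split /= -!mulr_suml -/kv -/ku
        lerD2l lerN2.
    rewrite -mulr_sumr -[leLHS]mulr1 ler_pM2l //.
    rewrite (bigD1 j0) //= /a /b ev0 hu0 mulr1 lerDl.
    by apply: sumr_ge0 => j _; rewrite mulr_ge0.
  by rewrite !lerD // ler_wpM2l //; lra.
pose s := 2 - p - q; pose L := lv + lu.
(* Squares are completed first in g, then in 1 - p and 1 - q with their sum s fixed, and finally in
   s. *)
have fin : 3 + 2 * s + 2 * g * s - L * g ^+ 2 - lv * (1 - p) ^+ 2
    - lu * (1 - q) ^+ 2 - L / D =
  3 - (L * (g - s / L) ^+ 2 + (lv * (1 - p) - lu * (1 - q)) ^+ 2 / L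
       + D / L * (s - L / D) ^+ 2).
  rewrite /s /L /D; field.
  by rewrite !gt_eqF.
have fin0 : 0 <= L * (g - s / L) ^+ 2 + (lv * (1 - p) - lu * (1 - q)) ^+ 2 / L
       + D / L * (s - L / D) ^+ 2.
  have L0 := ltW lL; have D0' := ltW D0.
  apply: addr_ge0; first apply: addr_ge0.
  - by rewrite mulr_ge0 ?sqr_ge0.
  - by rewrite divr_ge0 ?sqr_ge0.
  - by rewrite mulr_ge0 ?sqr_ge0 // divr_ge0.
have e1 : (kv * lu + ku * lv - 2) / D = 2 - L / D.
  have -> : kv = lv - 1 by rewrite /lv; ring.
  have -> : ku = lu - 1 by rewrite /lu; ring.
  by rewrite /L /D; field; rewrite gt_eqF.
rewrite e1 in Hs.
have ev : lv = kv + 1 by []. have eu : lu = ku + 1 by [].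
have Lg : L * g ^+ 2 = kv * g ^+ 2 + ku * g ^+ 2 + 2 * g ^+ 2.
  by rewrite /L /lv /lu; ring.
have lvp : lv * (1 - p) ^+ 2 = kv * (1 - p) ^+ 2 + (1 - p) ^+ 2.
  by rewrite /lv; ring.
have luq : lu * (1 - q) ^+ 2 = ku * (1 - q) ^+ 2 + (1 - q) ^+ 2.
  by rewrite /lu; ring.
rewrite Lg lvp luq in fin.
move: Hs fin fin0 e0; rewrite /s; set LD := L / D.
by set Z := _ + _ + D / L * _; set X := energy _ _; lra.
Qed.

Lemma energy_triangle_le e v (T : {set 'I_n}) P :
    symmetric e -> irreflexive e -> contraction P -> \tr P = 2 ->
    (4 <= deg e v)%N -> #|T| = 3%N ->
    (forall i j, del e v i j = [&& i \in T, j \in T & i != j]) ->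
  energy e P <= (esize e)%:R + 3.
Proof.
move=> es ei cP trP k4 T3 HT; have Ps := contraction_sym cP.
have hs := del_sym v es; have hi := del_irr v ei.
pose t j : R := (j \in T)%:R; pose a j : R := (e v j)%:R.
have vT : v \notin T.
  apply/negP => vT; have [w wT nvw] : exists2 w, w \in T & v != w.
    have /card_gt0P[w] : (0 < #|T :\ v|)%N by move: T3; rewrite (cardsD1 v) vT
        add1n => -[->].
    by rewrite !inE => /andP[nwv wT]; exists w => //; rewrite eq_sym.
  by have := HT v w; rewrite vT wT nvw /del eqxx andbF.
have tT : \sum_j t j = 3.
  rewrite /t -natr_sum; congr _%:R.
  by rewrite -[RHS]T3 -sum1_card [RHS]big_mkcond; apply: eq_bigr => j _; case:
      (j \in T).
have aa j : a j ^+ 2 = a j := natr_bool_sqr _.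
have tt j : t j ^+ 2 = t j := natr_bool_sqr _.
pose y : 'rV[R]_n := \row_j t j.
have nsy : sqnorm y = 3.
  by rewrite -tT; apply: eq_bigr => j _; rewrite mxE tt.
pose B := bf P y y; pose p := P v v.
have HE : energy (del e v) P = \sum_j t j * P j j + B.
  rewrite /B bfE -big_split; apply: eq_bigr => i _ /=.
  rewrite (eq_bigr (fun j => t i * P i i * t j + t i * P i j * t j
      - (i == j)%:R * (t i * P i i + t i * P i j))); last first.
    move=> j _; rewrite HT -/(t i); have := tt i; rewrite /t.
    case: eqP => [<-|_]; case: (i \in T); case: (j \in T) => /= *; ring.
  rewrite sumrB big_split /= sum_pred1r -mulr_sumr tT.
  have -> : \sum_j y ord0 i * P i j * y ord0 j = \sum_j t i * P i j * t j.
    by apply: eq_bigr => j _; rewrite !mxE.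
  by ring.
rewrite (esize_del v es ei) (energy_del v es ei cP.1) HE -/p natrD.
have c3 : (esize (del e v))%:R = 3 :> R.
  have : 2 * (esize (del e v))%:R = 6 :> R.
    rewrite -natr_esize //.
    have -> : 6 = \sum_i (t i * (\sum_j t j) - t i) :> R.
      by rewrite sumrB -mulr_suml tT; ring.
    apply: eq_bigr => i _; rewrite natr_deg.
    rewrite -[X in _ = _ - X](sum_pred1r i (fun=> t i)) mulr_sumr -sumrB.
    apply: eq_bigr => j _; rewrite HT -/(t i); have := tt i; rewrite /t.
    case: eqP => [<-|_]; case: (i \in T); case: (j \in T) => /= *; ring.
  by lra.
rewrite c3; set k := (deg e v)%:R; have k4' : 4 <= k by rewrite ler_nat.
have p0 : 0 <= p := contraction_diag_ge0 cP v.
have r2 : \sum_(j | j != v) P v j ^+ 2 <= p - p ^+ 2.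
  by have := contraction_row cP v; rewrite (bigD1 v) //= -lerBrDl.
have sv (F : 'I_n -> R) : \sum_j a j * F j = \sum_(j | j != v) a j * F j.
  by rewrite (bigD1 v) //= {1}/a ei mul0r add0r.
have st (F : 'I_n -> R) : \sum_j t j * F j = \sum_(j | j != v) t j * F j.
  by rewrite (bigD1 v) //= {1}/t (negPf vT) mul0r add0r.
have dk : \sum_(j | j != v) a j = k.
  by rewrite /k natr_deg [RHS](bigD1 v) //= ei add0r.
have dt : \sum_(j | j != v) t j = 3.
  by rewrite -tT [RHS](bigD1 v) //= {2}/t (negPf vT) add0r.
have Pj0 j := contraction_diag_ge0 cP j.
have sPj : \sum_(j | j != v) P j j = 2 - p by rewrite sum_diag_del trP.
have bfd i : bf P (delta_mx 0 i) y = \sum_j t j * P i j.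
  by rewrite /bf -rowE mxE; apply: eq_bigr => j _; rewrite !mxE mulrC.
have bfd' i : bf P y (delta_mx 0 i) = \sum_j t j * P i j.
  rewrite /bf trmx_delta -colE !mxE; apply: eq_bigr => j _.
  by rewrite !mxE [P j i]Ps.
pose Y := \sum_(j | j != v) t j * P v j.
(* The star at v gains 2 Y on T only at the expense of B, which is at most 3. *)
have YB : p + 2 * Y + B <= 4.
  have := contraction_le_sqnorm cP (delta_mx 0 v + y).
  rewrite bfDl !bfDr bf_delta bfd bfd' -/B -/p st -/Y.
  have -> : sqnorm (delta_mx 0 v + y) = 4.
    rewrite /sqnorm (bigD1 v) //= !mxE !eqxx /t (negPf vT) addr0 expr1n.
    rewrite (eq_bigr t) ?dt => [|j njv]; first by ring.
    by rewrite !mxE (negPf njv) andbF add0r tt.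
  by lra.
rewrite (sv (fun j => p + P j j + 2 * P v j)) (st (fun j => P j j)).
rewrite addrA.
have [TN|] := boolP [forall w in T, e v w].
  (* AM-GM is applied only to the k - 3 neighbours outside T, with parameter k - 2. *)
  have l0 : 0 < k - 2 by lra.
  have pw j : j != v -> a j * (p + P j j + 2 * P v j) + t j * P j j <=
      a j * p + 2 * P j j + 2 * (t j * P v j) + ((k - 2) * P v j ^+ 2 + (a j -
          t j) / (k - 2)).
    move=> njv; have := @weighted_amgm (k - 2) (a j - t j) (P v j) l0.
    have : t j <= a j.
      rewrite /t /a; case: (boolP (j \in T)) => [jT|_]; last by rewrite ler0n.
      by move/forall_inP: TN => ->.
    have := Pj0 j; rewrite /a /t; case: (e v j); case: (j \in T) => /= Pj ta.
    - by rewrite !subrr expr0n => /(_ erefl); lra.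
    - by rewrite !subr0 expr1n => /(_ erefl); lra.
    - by move: ta; rewrite lern0.
    - by rewrite !subrr expr0n => /(_ erefl); lra.
  have := ler_sum (index_enum _) pw; rewrite !big_split /= -!mulr_suml
      -!mulr_sumr.
  rewrite sumrB dk dt sPj -/Y => F1.
  have F2 : (k - 2) * (\sum_(j | j != v) P v j ^+ 2) <= (k - 2) * (p - p ^+ 2).
    by rewrite ler_wpM2l // ltW.
  have F3 : 0 <= ((k - 2) * (1 - p) - 1 / 2) ^+ 2 / (k - 2) by rewrite
      divr_ge0 ?sqr_ge0 // ltW.
  have F3E : ((k - 2) * (1 - p) - 1 / 2) ^+ 2 / (k - 2) =
     (k - 2) * (1 - p) ^+ 2 - (1 - p) + 1 / 4 / (k - 2) by field; rewrite
         gt_eqF.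
  have F4 : (k - 3) / (k - 2) = 1 - (k - 2)^-1 by field; rewrite gt_eqF.
  have F5 : 0 < (k - 2)^-1 by rewrite invr_gt0.
  rewrite F4 in F1; rewrite F3E in F3.
  by move: F1 F2 F3 F5 YB; set r := (k - 2)^-1; nra.
case/forall_inPn => w wT nvw.
have nwv : w != v by apply: contraNneq vT => <-.
have k0 : 0 < k by lra.
have pw j : j != v -> a j * (p + P j j + 2 * P v j) + t j * P j j <=
    a j * p + 2 * P j j - (w == j)%:R * P j j + (k * P v j ^+ 2 + a j / k).
  move=> njv; have := @weighted_amgm k (a j) (P v j) k0 (aa j).
  have := Pj0 j; case: eqP => [<-|_].
    by rewrite /a (negPf nvw) /t wT /= !mul0r; lra.
  by rewrite /a /t; case: (e v j); case: (j \in T) => /=; lra.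
have := ler_sum (index_enum _) pw; rewrite !big_split /= sumrN -!mulr_suml
    -!mulr_sumr.
rewrite dk sPj.
have -> : \sum_(j | j != v) (w == j)%:R * P j j = P w w.
  by rewrite -[RHS](sum_pred1r w (fun j => P j j)) [RHS](bigD1 v) //= (negPf
      nwv) mul0r add0r.
have F2 : k * (\sum_(j | j != v) P v j ^+ 2) <= k * (p - p ^+ 2).
  by rewrite ler_wpM2l // ltW.
(* Together these give B - P w w <= 41 / 15. *)
have G1 := contraction_le_sqnorm cP (y + (- 4^-1) *: delta_mx 0 w).
(* The coefficients 1/4 and 4 are reciprocal, so that [G2] scaled by 1/16 cancels the cross terms of
   [G1]. *)
have G2 := contraction_ge0 cP (y + (- 4) *: delta_mx 0 w).
have nsw : sqnorm (y + (- 4^-1) *: delta_mx 0 w) = 41 / 16.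
  rewrite /sqnorm (bigD1 w) //= (eq_bigr t) => [|j njw]; last first.
    by rewrite !mxE (negPf njw) andbF mulr0 addr0 tt.
  have -> : \sum_(j | j != w) t j = 2.
    by move: tT; rewrite (bigD1 w) //= {1}/t wT /=; lra.
  by rewrite !mxE !eqxx /t wT /= !mulr1; field.
rewrite nsw bfDl !bfDr !bfZl !bfZr bf_delta bfd bfd' -/B in G1.
rewrite bfDl !bfDr !bfZl !bfZr bf_delta bfd bfd' -/B in G2.
have F6 : k / k = 1 by rewrite mulfV // gt_eqF.
rewrite F6 => F1.
have F7 : 0 <= k * (1 - p - k^-1) ^+ 2 by rewrite mulr_ge0 ?sqr_ge0 // ltW.
have F8 : k * (1 - p - k^-1) ^+ 2 = k * (1 - p) ^+ 2 - 2 * (1 - p) + k^-1.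
  by field; rewrite gt_eqF.
have F9 : k^-1 <= 1 / 4.
  by rewrite -[1 / 4]invrK lef_pV2 ?posrE ?invr_gt0 //; lra.
by move: F1 F2 F7 F8 F9 G1 G2; set Z3 := \sum_j _; set r := k^-1; nra.
Qed.

End Families.

(** * Degree sums *)

Section Degrees.
Variable n : nat.
Implicit Types (e : rel 'I_n) (u v w : 'I_n).

(** Only the edge uv can be counted twice. *)
Lemma deg_pair_le e u v : symmetric e -> irreflexive e -> u != v ->
  (deg e u + deg e v <= (esize e).+1)%N.
Proof.
move=> es ei nuv; rewrite (esize_del u es ei) -addnS leq_add2l.
rewrite (@deg_del _ e u v) // 1?eq_sym // addnC.
rewrite (esize_del v (del_sym u es) (del_irr u ei)).
by have := leq_b1 (e u v); lia.
Qed.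

Lemma deg_le_esize e u : symmetric e -> irreflexive e ->
  (deg e u <= esize e)%N.
Proof. by move=> es ei; rewrite (esize_del u es ei) leq_addr. Qed.

(** [deg_sq] is the sum of d_i + d_j over the edges, and [deg_pair_le] bounds each term. *)
Lemma deg_sq_le e : symmetric e -> irreflexive e ->
  (deg_sq e <= esize e * (esize e).+1)%N.
Proof.
move=> es ei; rewrite -(leq_pmul2l (isT : 0 < 2)%N).
have E1 : deg_sq e = (\sum_i \sum_j e i j * deg e i)%N.
  by apply: eq_bigr => i _; rewrite -big_distrl /= expnS expn1.
have E2 : deg_sq e = (\sum_i \sum_j e i j * deg e j)%N.
  rewrite E1 exchange_big; apply: eq_bigr => i _; apply: eq_bigr => j _.
  by rewrite es.
rewrite mul2n -addnn {1}E1 E2 -big_split /= mulnA -sum_deg // big_distrl /=.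
apply: leq_sum => i _; rewrite -big_split /= {3}/deg big_distrl /=.
apply: leq_sum => j _; rewrite -mulnDr leq_mul2l.
have [eij|//] := boolP (e i j); apply/orP; right; apply: deg_pair_le => //.
by apply: contraL eij => /eqP ->; rewrite ei.
Qed.

Lemma deg_del_le e v i : symmetric e -> irreflexive e ->
  (deg (del e v) i <= deg e i)%N.
Proof.
move=> es ei; have [->|niv] := eqVneq i v; first by rewrite deg_delv.
by rewrite (deg_del ei es niv) leq_addr.
Qed.

Lemma nbr_deg_le e v : symmetric e -> irreflexive e ->
  (nbr_deg e v <= 2 * esize (del e v))%N.
Proof.
move=> es ei; rewrite -sum_deg; try exact: del_sym; try exact: del_irr.
by apply: leq_sum => j _; case: (e v j); rewrite ?mul1n ?mul0n.
Qed.

Lemma deg_card e v : deg e v = #|[set j | e v j]|.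
Proof.
rewrite /deg -sum1_card [RHS]big_mkcond; apply: eq_bigr => j _.
by rewrite inE; case: (e v j).
Qed.

Lemma nbr_degE e v :
  nbr_deg e v = (\sum_(j in [set j | e v j]) deg (del e v) j)%N.
Proof.
rewrite /nbr_deg [RHS]big_mkcond; apply: eq_bigr => j _.
by rewrite inE; case: (e v j); rewrite ?mul1n ?mul0n.
Qed.

Lemma sum_nbr_deg e v : symmetric e -> irreflexive e ->
  (\sum_j e v j * deg e j = nbr_deg e v + deg e v)%N.
Proof.
move=> es ei; rewrite /nbr_deg /deg -/(deg e) -/(deg (del e v)) -big_split /=.
apply: eq_bigr => j _; rewrite -/(deg e j) -/(deg (del e v) j).
case evj : (e v j); rewrite ?mul0n // !mul1n.
have njv : j != v by apply: contraTneq evj => ->; rewrite ei.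
by rewrite (deg_del ei es njv) evj.
Qed.

Lemma nbr_deg1 e v : symmetric e -> irreflexive e -> deg e v = 1%N ->
  exists u, (nbr_deg e v).+1 = deg e u.
Proof.
move=> es ei; rewrite deg_card => /eqP /cards1P[u Nu]; exists u.
rewrite nbr_degE Nu big_set1.
have evu : e v u by have := set11 u; rewrite -Nu inE.
have nuv : u != v by apply: contraTneq evu => ->; rewrite ei.
by rewrite (deg_del ei es nuv) evu addn1.
Qed.

Lemma nbr_deg2 e v : symmetric e -> irreflexive e -> deg e v = 2%N ->
  (nbr_deg e v <= (esize (del e v)).+1)%N.
Proof.
move=> es ei; rewrite deg_card => /eqP /cards2P[x [y [nxy Nxy]]].
rewrite nbr_degE Nxy big_setU1 ?inE //= big_set1.
by apply: deg_pair_le => //; [exact: del_sym|exact: del_irr].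
Qed.

Definition is_triangle e (T : {set 'I_n}) : bool :=
  (#|T| == 3%N) &&
  [forall i, forall j, e i j == [&& i \in T, j \in T & i != j]].

(** The single remaining edge has to join the two neighbours of v. *)
Lemma nbr_deg_triangle e v : symmetric e -> irreflexive e ->
    deg e v = 2%N -> esize (del e v) = 1%N -> nbr_deg e v = 2%N ->
  exists T, is_triangle e T.
Proof.
move=> es ei; rewrite deg_card => /eqP /cards2P[x [y [nxy Nxy]]] j1.
have hs := del_sym v es; have hi := del_irr v ei.
rewrite nbr_degE Nxy big_setU1 ?inE //= big_set1 => dxy.
have := deg_le_esize x hs hi; have := deg_le_esize y hs hi; rewrite j1 => y1 x1.
have dx : deg (del e v) x = 1%N by lia.
have dy : deg (del e v) y = 1%N by lia.
have sub z : (0 < deg (del e v) z)%N -> z \in [set x; y].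
  move=> dz; rewrite !inE; apply/norP => -[nzx nzy].
  have := sum_deg hs hi; rewrite j1 muln1 (bigD1 x) //= (bigD1 y) 1?eq_sym //=.
  rewrite (bigD1 z) /=; last by rewrite nzx nzy.
  by rewrite dx dy; lia.
have Nv z : e v z = (z \in [set x; y]) by rewrite -Nxy inE.
have nzv z : z \in [set x; y] -> z != v.
  by rewrite -Nv; apply: contraTneq => ->; rewrite ei.
have hxy : del e v x y.
  have [z hxz] : exists z, del e v x z.
    apply/existsP; rewrite -[X in is_true X]negbK negb_exists; apply/negP.
    move/forallP => H; move: dx; rewrite /deg big1 // => z _.
    by rewrite (negPf (H z)).
  have : z \in [set x; y].
    by apply: sub; apply: (@deg_gt0 _ (del e v) z x); rewrite hs.
  rewrite !inE => /orP[/eqP zx|/eqP <- //].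
  by move: hxz; rewrite zx hi.
have exy : e x y by case/and3P: hxy.
have vT : v \notin [set x; y] by rewrite -Nv ei.
exists (v |: [set x; y]); apply/andP; split.
  by rewrite cardsU1 vT cards2 nxy.
apply/forallP => i; apply/forallP => j; apply/eqP.
rewrite ![_ \in v |: _]in_setU1.
have [->|niv] := eqVneq i v; rewrite /=.
  rewrite Nv; have [->|njv] := eqVneq j v; first by rewrite (negPf vT).
  by rewrite ?andbT.
have [->|njv] := eqVneq j v; first by rewrite es Nv ?eqxx ?niv ?andbT.
have -> : e i j = del e v i j by rewrite /del niv njv !andbT.
apply/idP/idP => [hij|].
  rewrite !sub /=; first by apply: contraTneq hij => ->; rewrite hi.
    by apply: (@deg_gt0 _ _ j i); rewrite hs.
  exact: deg_gt0 hij.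
move=> /= /and3P[]; rewrite !inE => /orP[]/eqP -> /orP[]/eqP -> nn //.
- by rewrite eqxx in nn.
- by rewrite hs.
- by rewrite eqxx in nn.
Qed.

End Degrees.

(** * The induction *)

Section Main.
Variables (R : realType) (n : nat).
Implicit Types (e : rel 'I_n) (u v w : 'I_n) (P : 'M[R]_n).

(* The choice of g makes the trace bound depend on the degrees only through
   the combination deg_sq + s * supp_size. *)
Lemma energy_trace_supp_le e P (s B m : nat) (c l g M : R) :
    symmetric e -> irreflexive e -> contraction P -> \tr P = 2 ->
    esize e = m -> (0 < m)%N -> (0 < s)%N ->
    (deg_sq e + s * supp_size e <= B)%N -> 0 <= c -> 0 < l -> 0 <= g ->
    2 * g * s%:R = m%:R * (s%:R - c ^+ 2) ->
    c ^+ 2 * B%:R + s%:R * (2 * m%:R + g ^+ 2 - 4 * c * m%:R + 2 * c * g) <=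
      2 * l * s%:R * (M - g - 2 * c - l) ->
  energy e P <= M.
Proof.
move=> es ei cP trP em m0 s0 HB c0 l0 g0 gE HM.
have m0' : (0 < esize e)%N by rewrite em.
apply: le_trans (energy_trace_le es ei cP trP m0' g0 c0 l0) _; rewrite em.
set N : R := (supp_size e)%:R; set sg : R := (deg_sq e)%:R.
have HB' : sg + s%:R * N <= B%:R by rewrite /sg /N -natrM -natrD ler_nat.
have mR : 0 < m%:R :> R by rewrite ltr0n.
have sR : 0 < s%:R :> R by rewrite ltr0n.
set m' : R := m%:R in mR gE HM *; set s' : R := s%:R in sR HB' gE HM *.
(* This makes the coefficients of [deg_sq] and [supp_size] stand in the ratio 1 : s. *)
have gm : 1 - 2 * g / m' = c ^+ 2 / s'.
  have -> : g = m' * (s' - c ^+ 2) / (2 * s').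
    by rewrite -gE; field; rewrite gt_eqF.
  by field; rewrite !gt_eqF.
rewrite gm -lerBrDl ler_pdivrMr ?mulr_gt0 // -(ler_pM2r sR).
have c2 : 0 <= c ^+ 2 := sqr_ge0 c.
have cB : c ^+ 2 * (sg + s' * N) <= c ^+ 2 * B%:R by rewrite ler_wpM2l.
have -> : (sg * (c ^+ 2 / s') + c ^+ 2 * N + 2 * m' + g ^+ 2 - 4 * c * m'
   + 2 * c * g) * s' = c ^+ 2 * (sg + s' * N)
   + s' * (2 * m' + g ^+ 2 - 4 * c * m' + 2 * c * g).
  by field; rewrite gt_eqF.
by move: cB HM; set X := c ^+ 2 * _; set Y := c ^+ 2 * _; lra.
Qed.

Lemma energy_deg_le3 e P :
    symmetric e -> irreflexive e -> contraction P -> \tr P = 2 ->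
    (forall i, deg e i <= 3)%N ->
  energy e P <= (esize e)%:R + 3.
Proof.
move=> es ei cP trP d3; have [m3|m3] := leqP (esize e) 3.
  apply: le_trans (energy_le_double es ei cP) _.
  have : (esize e)%:R <= 3 :> R by rewrite ler_nat.
  by lra.
(* For 1 <= d <= 3, (d - 1) (d - 3) <= 0, that is d^2 + 3 <= 4 d. *)
have sN : (deg_sq e + 3 * supp_size e <= 8 * esize e)%N.
  have -> : (8 * esize e = 4 * (2 * esize e))%N by lia.
  rewrite -sum_deg // /deg_sq /supp_size !big_distrr /= -big_split /=.
  by apply: leq_sum => i _; have := d3 i; case: (deg e i) => [|[|[|[|]]]].
have S2 : (deg_sq e <= 6 * esize e)%N.
  have -> : (6 * esize e = 3 * (2 * esize e))%N by lia.
  rewrite -sum_deg // /deg_sq big_distrr /=.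
  by apply: leq_sum => i _; have := d3 i; case: (deg e i) => [|[|[|[|]]]].
(* With c = g = 0 and l = (m + 3) / 2 the trace bound needs 16 m <= (m + 3)^2, true from m = 9 on.
   For m from 4 to 8, c and l are chosen per case and g = m (3 - c^2) / 6 follows. *)
have [m9|m9] := leqP 9 (esize e).
  have m0 : (0 < esize e)%N by lia.
  have m9' : 9 <= (esize e)%:R :> R by rewrite ler_nat.
  have S2' : (deg_sq e)%:R <= 6 * (esize e)%:R :> R by rewrite -natrM ler_nat.
  set m : R := (esize e)%:R in m9' S2' *.
  have l0 : 0 < (m + 3) / 2 by lra.
  apply: le_trans (energy_trace_le es ei cP trP m0 (lexx 0) (lexx 0) l0) _.
  have l2 : 0 < 2 * ((m + 3) / 2) by lra.
  rewrite -/m -lerBrDl ler_pdivrMr //.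
  by rewrite !mulr0 !mul0r expr0n /=; nra.
have : esize e \in iota 4 5 by rewrite mem_iota m3 m9.
rewrite /= !inE.
case/or4P => [/eqP m4|/eqP m5|/eqP m6|/orP[/eqP m7|/eqP m8]].
- rewrite m4; rewrite m4 in sN.
  by apply: (energy_trace_supp_le (c := 1 / 2) (l := 2) (g := 11 / 6)
    es ei cP trP m4 _ _ sN) => //; lra.
- rewrite m5; rewrite m5 in sN.
  by apply: (energy_trace_supp_le (c := 1 / 2) (l := 5 / 2) (g := 55 / 24)
    es ei cP trP m5 _ _ sN) => //; lra.
- rewrite m6; rewrite m6 in sN.
  by apply: (energy_trace_supp_le (c := 1) (l := 2) (g := 2)
    es ei cP trP m6 _ _ sN) => //; lra.
- rewrite m7; rewrite m7 in sN.
  by apply: (energy_trace_supp_le (c := 1) (l := 3) (g := 7 / 3)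
    es ei cP trP m7 _ _ sN) => //; lra.
- rewrite m8; rewrite m8 in sN.
  by apply: (energy_trace_supp_le (c := 1) (l := 3) (g := 8 / 3)
    es ei cP trP m8 _ _ sN) => //; lra.
Qed.

(* w maximizes the sum of its degree and the mean degree of its neighbours. *)
Lemma top_eigenvalue_del_le (h : rel 'I_n) : symmetric h -> irreflexive h ->
    (0 < esize h)%N ->
  exists2 w, (0 < deg h w)%N &
    (eigenvalues (qmx R h))`_0 <=
      (esize h)%:R + 1 - (esize (del h w))%:R + (nbr_deg h w)%:R / (deg h w)%:R.
Proof.
move=> hs hi m0.
have [w0 dw0] : exists w, (0 < deg h w)%N.
  apply/existsP; apply: contraLR m0; rewrite negb_exists => /forallP H.
  rewrite -leqNgt -(leq_pmul2l (isT : 0 < 2)%N) -sum_deg // muln0 leqn0.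
  by rewrite sum_nat_eq0; apply/forallP => i; have := H i; rewrite -eqn0Ngt.
pose F i : R := (deg h i ^ 2 + \sum_j h i j * deg h j)%N%:R / (deg h i)%:R.
case: (@Order.TotalTheory.arg_maxP _ _ _ w0 (fun i => 0 < deg h i)%N F dw0)
  => w dw wmax; exists w => //.
have dwR : 0 < (deg h w)%:R :> R by rewrite ltr0n.
have Fw : F w = (esize h)%:R + 1 - (esize (del h w))%:R + (nbr_deg h w)%:R /
    (deg h w)%:R.
  rewrite /F sum_nbr_deg // (esize_del w hs hi) !natrD natrX.
  by field; rewrite gt_eqF.
rewrite -Fw; apply: top_eigenvalue_le => //.
- by apply: leq_trans (ltn_ord w).
- by rewrite /F divr_ge0.
move=> i di; have : F i <= F w := wmax i di.
by rewrite {1}/F ler_pdivrMr ?ltr0n.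
Qed.

End Main.

Section Induction.
Variables (R : realType) (n : nat).
Hypothesis n2 : (2 <= n)%N.
Implicit Types (e : rel 'I_n) (u v w : 'I_n) (P : 'M[R]_n).

Let E0 e : R := (eigenvalues (qmx R e))`_0.
Let E1 e : R := (eigenvalues (qmx R e))`_1.

Lemma energy_attained e : symmetric e ->
  exists P, [/\ contraction P, \tr P = 2 & energy e P = E0 e + E1 e].
Proof.
move=> es; have [P [cP trP PE]] := ky_fan_attained n2 (qmx_sym R es).
by exists P; split=> //; rewrite -PE mxtrace_qmx //; exact: cP.1.
Qed.

Lemma energy_elim_le3 e v P (mu : R) (h := del e v) (k := (deg e v)%:R : R) :
    symmetric e -> irreflexive e -> contraction P -> \tr P = 2 ->
    E0 h + E1 h <= (esize h)%:R + 3 -> E0 h <= (esize h)%:R + mu ->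
    mu < k -> k <= (2 - mu) * (k - 2) ->
  energy e P <= (esize e)%:R + 3.
Proof.
move=> es ei cP trP IH Hmu k0 Hk.
apply: (energy_elim_le (v := v) (mu := mu) (x := 3)) => //; rewrite -/h -/k.
  by lra.
by have -> : k + 1 - 3 = k - 2 by ring.
Qed.

(* By top_eigenvalue_del_le, q_1(h) can exceed the number d + j of edges of h
   only if t > d (j - 1), that is, only outside the first case. *)
Lemma witness_cases (h : rel 'I_n) w (d := deg h w)
    (j := esize (del h w)) (t := nbr_deg h w) :
    symmetric h -> irreflexive h -> (0 < d)%N ->
    (forall u, esize h != deg h u) -> (forall T, ~~ is_triangle h T) ->
  [\/ (t <= d * j.-1)%N,
      [/\ d = 2, j = 1 & t = 1]%N,
      [/\ d = 2, j = 2 & t = 3]%N |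
      (3 <= d)%N /\ (j = 1 /\ t <= 2 \/ [/\ d = 3, j = 2 & t = 4])%N].
Proof.
move=> hs hi d0 nstar ntri.
have sz : esize h = (d + j)%N := esize_del w hs hi.
have j0 : (0 < j)%N by have := nstar w; rewrite sz -/d; lia.
have t2 : (t <= 2 * j)%N := nbr_deg_le w hs hi.
have [d1|d1] := eqVneq d 1%N.
  have [u tu] := nbr_deg1 hs hi d1; have := nstar u.
  have := deg_le_esize u hs hi; rewrite sz -tu -/t d1 => tj nt.
  by constructor 1; lia.
have [d2|d2] := eqVneq d 2%N.
  have tj : (t <= j.+1)%N := nbr_deg2 hs hi d2.
  have [tn|tn] := leqP t (d * j.-1); first by constructor 1.
  have [j1|j1] := eqVneq j 1%N.
    constructor 2; split=> //; rewrite j1 in t2 tn.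
    have : t != 2%N.
      apply/eqP => tt; have [T TT] := nbr_deg_triangle hs hi d2 j1 tt.
      by have := ntri T; rewrite TT.
    by lia.
  by constructor 3; split=> //; lia.
have d3 : (3 <= d)%N by lia.
have [tn|tn] := leqP t (d * j.-1); first by constructor 1.
constructor 4; split=> //; have [j1|j1] := eqVneq j 1%N.
  by left; lia.
(* From d (j - 1) < t <= 2 j and d >= 3 it follows that j < 3. *)
right; have j2 : j = 2%N by nia.
by rewrite j2 /= muln1 in tn t2; split=> //; lia.
Qed.

(** This sharpens the constant 3 for a triangle with a pendant edge. The choice g = m / 2 removes
    [deg_sq] from the trace bound, and the support has at most 4 vertices. *)
Lemma paw_eigenvalue_sum_le (h : rel 'I_n) w : symmetric h -> irreflexive h ->
    deg h w = 3%N -> esize (del h w) = 1%N -> nbr_deg h w = 2%N ->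
  E0 h + E1 h <= (esize h)%:R + 11 / 4.
Proof.
move=> hs hi d3 j1 t2; have [P [cP trP <-]] := energy_attained hs.
have m4 : esize h = 4%N by rewrite (esize_del w hs hi) d3 j1.
have m0 : (0 < esize h)%N by rewrite m4.
have N4 : (supp_size h <= 4)%N.
  by have := supp_size_del w hs hi; rewrite d3 j1 t2; lia.
have g0 : 0 <= 2 :> R by lra.
have c0 : 0 <= 3 / 4 :> R by lra.
have l0 : 0 < 8 / 5 :> R by lra.
apply: le_trans (energy_trace_le hs hi cP trP m0 g0 c0 l0) _.
have N4' : (supp_size h)%:R <= 4 :> R by rewrite ler_nat.
rewrite m4; have -> : 1 - 2 * 2 / 4 = 0 :> R by field.
rewrite mulr0 -lerBrDl ler_pdivrMr; last by lra.
by lra.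
Qed.

Lemma energy_le_esize e P :
    symmetric e -> irreflexive e -> contraction P -> \tr P = 2 ->
    (forall h : rel 'I_n, symmetric h -> irreflexive h ->
       (esize h < esize e)%N -> E0 h + E1 h <= (esize h)%:R + 3) ->
  energy e P <= (esize e)%:R + 3.
Proof.
move=> es ei cP trP IH.
pose v0 := Ordinal (leq_trans (isT : 0 < 2)%N n2).
case: (@arg_maxnP _ v0 xpredT (deg e) isT) => v _ vmax.
have {}vmax i : (deg e i <= deg e v)%N by apply: vmax.
have [k3|k4] := leqP (deg e v) 3.
  by apply: energy_deg_le3 => // i; apply: leq_trans (vmax i) k3.
pose h := del e v.
have hs : symmetric h := del_sym v es; have hi : irreflexive h := del_irr v ei.
have m : esize e = (deg e v + esize h)%N := esize_del v es ei.
(* The star costs at most k + 2 and the c remaining edges at most 2 c <= c + 1. *)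
have [c1|c2] := leqP (esize h) 1.
  apply: le_trans (energy_star_le v es ei cP trP) _.
  have := energy_le_double hs hi cP; rewrite m natrD -/h.
  have : (esize h)%:R <= 1 :> R by rewrite lern1.
  by lra.
have [/existsP[u /eqP star]|nstar] := boolP [exists u, esize h == deg h u].
  by apply: (energy_two_centers_le es ei cP trP (u := u) (v := v)) => //;
    [exact: ltnW|rewrite -star].
have {}nstar u : esize h != deg h u by move/existsPn/(_ u): nstar.
have [/existsP[T /andP[/eqP T3 /'forall_'forall_eqP TE]]|ntri] :=
    boolP [exists T, is_triangle h T].
  by apply: (energy_triangle_le es ei cP trP k4 T3).
have {}ntri T : ~~ is_triangle h T by move/existsPn/(_ T): ntri.
have IHh : E0 h + E1 h <= (esize h)%:R + 3.
  by apply: IH => //; rewrite m; lia.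
have h0 : (0 < esize h)%N by lia.
have [w dw E0h] := top_eigenvalue_del_le R hs hi h0.
have k4' : 4 <= (deg e v)%:R :> R by rewrite ler_nat.
(* For mu = 0, 1/3, 1/2, 2/3 the last condition holds once the degree of v is at least 4, 5, 6, 8
   respectively; these are the thresholds of the cases below. *)
have elim mu : E0 h <= (esize h)%:R + mu -> mu < 4 ->
    (deg e v)%:R <= (2 - mu) * ((deg e v)%:R - 2) ->
    energy e P <= (esize e)%:R + 3.
  by move=> Hmu mu4; apply: energy_elim_le3 => //; lra.
have szh : esize h = (deg h w + esize (del h w))%N := esize_del w hs hi.
set d := deg h w in dw E0h szh *; set j := esize (del h w) in E0h szh *.
set t := nbr_deg h w in E0h *.
have sgh : (deg_sq h <= d ^ 2 + d + j * j.+1 + 2 * t)%N.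
  rewrite (deg_sq_del w hs hi) -/d -/t !leq_add2r leq_add2l.
  by apply: deg_sq_le; [exact: del_sym|exact: del_irr].
have dk : (d <= deg e v)%N by apply: leq_trans (vmax w); apply: deg_del_le.
(* The weight 2 on the support cancels the term 2 [nbr_deg] of [deg_sq_del]. *)
have sge : (deg_sq e + 2 * supp_size e <=
    deg e v ^ 2 + 3 * deg e v + deg_sq h + 4 * esize h + 2)%N.
  have := supp_size_del v es ei; rewrite (deg_sq_del v es ei) -/h.
  by set N := nbr_deg e v; lia.
have trace (B mm : nat) (c l g : R) : esize e = mm -> (0 < mm)%N ->
    (deg e v ^ 2 + 3 * deg e v + (d ^ 2 + d + j * j.+1 + 2 * t)
      + 4 * (d + j) + 2 <= B)%N ->
    0 <= c -> 0 < l -> 0 <= g -> 2 * g * 2 = mm%:R * (2 - c ^+ 2) ->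
    c ^+ 2 * B%:R + 2 * (2 * mm%:R + g ^+ 2 - 4 * c * mm%:R + 2 * c * g) <=
      2 * l * 2 * (mm%:R + 3 - g - 2 * c - l) ->
    energy e P <= (esize e)%:R + 3.
  move=> emm mm0 HB c0 l0 g0 gE HM; rewrite emm.
  have HB' : (deg_sq e + 2 * supp_size e <= B)%N by rewrite szh in sge; lia.
  exact: (energy_trace_supp_le es ei cP trP emm mm0 _ HB' c0 l0 g0 gE HM).
rewrite szh in m; have dR : 0 < d%:R :> R by rewrite ltr0n.
(* The arguments c, l, g of trace come from a numerical minimisation of the
   bound of energy_trace_le. *)
case: (witness_cases hs hi dw nstar ntri); rewrite -/d -/j -/t.
- move=> tn; apply: (elim 0); [|lra|lra]; apply: le_trans E0h _.
  have j0 : (0 < j)%N by have := nstar w; rewrite szh -/d; lia.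
  have : t%:R / d%:R <= j%:R - 1 :> R; last by lra.
  rewrite ler_pdivrMr // (_ : _ * _ = (d * j.-1)%:R) ?ler_nat //.
  by rewrite natrM -subn1 natrB //; ring.
- move=> [d2 j1 t1]; rewrite d2 j1 t1 in m E0h trace.
  have [k6|k6] := leqP 6 (deg e v).
    have k6' : 6 <= (deg e v)%:R :> R by rewrite ler_nat.
    by apply: (elim (1 / 2)); [apply: le_trans E0h _; lra|lra|lra].
  have /orP[/eqP k5|/eqP kk] : (deg e v == 5)%N || (deg e v == 4)%N by lia.
  + by rewrite k5 in m trace; apply: (trace 64 8 1 3 2) => //; lra.
  + by rewrite kk in m trace; apply: (trace 52 7 1 3 (7 / 4)) => //; lra.
- move=> [d2 j1 t1]; rewrite d2 j1 t1 in m E0h trace.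
  have [k6|k6] := leqP 6 (deg e v).
    have k6' : 6 <= (deg e v)%:R :> R by rewrite ler_nat.
    by apply: (elim (1 / 2)); [apply: le_trans E0h _; lra|lra|lra].
  have /orP[/eqP k5|/eqP kk] : (deg e v == 5)%N || (deg e v == 4)%N by lia.
  + by rewrite k5 in m trace; apply: (trace 76 9 1 4 (9 / 4)) => //; lra.
  + by rewrite kk in m trace; apply: (trace 64 8 1 3 2) => //; lra.
move=> [d3 [[j1 tle]|[dE j2 t4]]]; last first.
  rewrite dE j2 t4 in m E0h trace.
  have [k5|k5] := leqP 5 (deg e v).
    have k5' : 5 <= (deg e v)%:R :> R by rewrite ler_nat.
    by apply: (elim (1 / 3)); [apply: le_trans E0h _; lra|lra|lra].
  have kk : deg e v = 4%N by lia.
  by rewrite kk in m trace; apply: (trace 76 9 1 4 (9 / 4)) => //; lra.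
have E0h' (mu : R) : t%:R <= mu * d%:R -> E0 h <= (esize h)%:R + mu.
  move=> tmu; apply: le_trans E0h _; rewrite j1 addrK lerD2l.
  by rewrite ler_pdivrMr.
have d3' : 3 <= d%:R :> R by rewrite ler_nat.
have t2' : t%:R <= 2 :> R by rewrite ler_nat.
have [k8|k8] := leqP 8 (deg e v).
  have k8' : 8 <= (deg e v)%:R :> R by rewrite ler_nat.
  by apply: (elim (2 / 3)); [apply: E0h'; lra|lra|lra].
have [t1|t2] := leqP t 1.
  have t1' : t%:R <= 1 :> R by rewrite lern1.
  have [k5|k5] := leqP 5 (deg e v).
    have k5' : 5 <= (deg e v)%:R :> R by rewrite ler_nat.
    by apply: (elim (1 / 3)); [apply: E0h'; lra|lra|lra].
  have kk : deg e v = 4%N by lia.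
  have /orP[/eqP dd|/eqP dd] : (d == 3)%N || (d == 4)%N by lia.
    rewrite kk dd j1 in m trace.
    by apply: (trace 64 8 1 3 2) => //; [lia|lra..].
  rewrite kk dd j1 in m trace.
  by apply: (trace 76 9 1 4 (9 / 4)) => //; [lia|lra..].
have tE : t = 2%N by lia.
(* For d = 3, h is a triangle with a pendant edge, and possibly isolated
   vertices. *)
have [d4|d4] := leqP 4 d; last first.
  have dE : d = 3%N by lia.
  have [k7|k7] := leqP 7 (deg e v).
    have kE : deg e v = 7%N by lia.
    (* For degree 7 the condition k <= (2 - mu) (k + 1 - x) fails with x = 3 and is an equality with
       x = 11/4. *)
    apply: (energy_elim_le (v := v) (mu := 2 / 3) (x := 11 / 4)) => //.
    - by apply: E0h'; rewrite dE tE; lra.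
    - exact: paw_eigenvalue_sum_le dE j1 tE.
    - by rewrite kE; lra.
    - by rewrite kE; lra.
  rewrite dE j1 tE in m trace.
  have /or3P[/eqP kE|/eqP kE|/eqP kE] :
    [|| deg e v == 4, deg e v == 5 | deg e v == 6]%N by lia.
  + by rewrite kE in m trace; apply: (trace 64 8 1 3 2) => //; lra.
  + by rewrite kE in m trace; apply: (trace 76 9 1 4 (9 / 4)) => //; lra.
  + by rewrite kE in m trace; apply: (trace 90 10 (6 / 5) (9 / 2) (7 / 5)) =>
      //; lra.
have d4' : 4 <= d%:R :> R by rewrite ler_nat.
have [k6|k6] := leqP 6 (deg e v).
  have k6' : 6 <= (deg e v)%:R :> R by rewrite ler_nat.
  by apply: (elim (1 / 2)); [apply: E0h'; lra|lra|lra].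
have [d6|d6] := leqP 6 d; first by lia.
have /orP[/eqP kE|/eqP kE] : (deg e v == 4)%N || (deg e v == 5)%N by lia.
  have dE : d = 4%N by lia.
  by rewrite kE dE j1 tE in m trace; apply: (trace 76 9 1 4 (9 / 4)) => //;
      lra.
have /orP[/eqP dE|/eqP dE] : (d == 4)%N || (d == 5)%N by lia.
  by rewrite kE dE j1 tE in m trace; apply: (trace 88 10 1 4 (5 / 2)) => //;
      lra.
by rewrite kE dE j1 tE in m trace; apply: (trace 102 11 1 5 (11 / 4)) => //;
    lra.
Qed.

(** Strong induction on the number of edges, with P the matrix that attains q_1 + q_2. *)
Lemma eigenvalue_sum_le e : symmetric e -> irreflexive e ->
  E0 e + E1 e <= (esize e)%:R + 3.
Proof.
have [m] := ubnP (esize e); elim: m e => // m IHm e em es ei.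
have [P [cP trP <-]] := energy_attained es.
apply: energy_le_esize => // h hs hi hm; apply: IHm => //.
exact: leq_trans hm em.
Qed.

End Induction.

(** * Indexing the vertices *)

Section Transfer.
Variable V : finType.
Implicit Types (e : rel V).

Definition ord_rel e : rel 'I_#|V| := fun i j => e (enum_val i) (enum_val j).

Lemma deg_ord_rel e i : deg (ord_rel e) i = degree e (enum_val i).
Proof.
rewrite deg_card /degree -(card_imset _ (@enum_val_inj _ _)).
apply: eq_card => y; rewrite [RHS]inE; apply/imsetP/idP => [[j]|exy].
  by rewrite inE => eij ->.
by exists (enum_rank y); rewrite ?inE /ord_rel enum_rankK.
Qed.

Lemma signless_laplacian_qmx (R : realType) e :
  signless_laplacian R e = qmx R (ord_rel e).
Proof.
apply/matrixP => i j; rewrite !mxE deg_ord_rel; congr (_ + _).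
by case: eqP; rewrite ?mulr1n ?mulr1 ?mulr0n ?mulr0.
Qed.

(** Each edge is the image under [f] of exactly one increasing pair of indices; irreflexivity
    excludes one-element sets. *)
Lemma edge_count_esize e : symmetric e -> irreflexive e ->
  edge_count e = esize (ord_rel e).
Proof.
move=> es ei; pose S := [set p : 'I_#|V| * 'I_#|V| |
  (p.1 < p.2)%N && ord_rel e p.1 p.2].
pose f (p : 'I_#|V| * 'I_#|V|) : {set V} := [set enum_val p.1; enum_val p.2].
have finj : {in S &, injective f}.
  move=> [a b] [c d]; rewrite !inE /= => /andP[ab _] /andP[cd _] /setP E.
  have [a1 b1] : (a == c) || (a == d) /\ (b == c) || (b == d).
    move: (E (enum_val a)) (E (enum_val b)); rewrite !inE !eqxx orbT /=.
    by rewrite !(inj_eq enum_val_inj) => <- <-.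
  case/orP: a1 => /eqP aE; case/orP: b1 => /eqP bE; rewrite ?aE ?bE //.
  - by move: ab; rewrite aE bE ltnn.
  - by move: ab; rewrite aE bE ltnNge ltnW.
  - by move: ab; rewrite aE bE ltnn.
have -> : edge_count e = #|S|.
  rewrite /edge_count -(card_in_imset finj); apply: eq_card => E.
  rewrite inE; apply/existsP/imsetP => [[x /existsP[y /andP[exy /eqP ->]]]|].
    have nxy : enum_rank x != enum_rank y.
      by rewrite (inj_eq enum_rank_inj); apply: contraTneq exy => ->; rewrite
          ei.
    move: nxy; rewrite neq_ltn => /orP[lt|lt].
      exists (enum_rank x, enum_rank y); rewrite ?inE /f /ord_rel /=
          ?enum_rankK //.
      by rewrite lt.
    exists (enum_rank y, enum_rank x); rewrite ?inE /f /ord_rel /= ?enum_rankK.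
      by rewrite lt es.
    by rewrite setUC.
  case=> -[a b]; rewrite inE /= => /andP[_ eab] ->.
  by exists (enum_val a); apply/existsP; exists (enum_val b); rewrite [e _
      _]eab eqxx.
rewrite -sum1_card big_mkcond /esize.
pose F (i j : 'I_#|V|) := if (i < j)%N then nat_of_bool (ord_rel e i j) else
    0%N.
rewrite (eq_bigr (fun p => F p.1 p.2)) => [|p _]; last first.
  by rewrite inE /F; case: (p.1 < p.2)%N => //; case: (ord_rel e _ _).
rewrite -(pair_bigA _ F) /=.
by apply: eq_bigr => i _; rewrite [RHS]big_mkcond.
Qed.

End Transfer.

Theorem mainTheorem2 (R : realType) (V : finType) (e : rel V)
    (e_sym : symmetric e) (e_irr : irreflexive e)
    (e_conn : connected_graph e) (V_ge2 : (2 <= #|V|)%N) :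
  S2 R e <= (edge_count e + 3)%:R.
Proof.
rewrite /S2 /signless_eigenvalue signless_laplacian_qmx natrD.
rewrite (edge_count_esize e_sym e_irr).
by apply: eigenvalue_sum_le => // [i j|i]; rewrite /ord_rel ?e_irr // e_sym.
Qed.
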